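(* Let $U:\mathbb{R}^d\to\mathbb{R}$ be twice differentiable and suppose there exist $\mu\in(0,+\infty)$ and $L\in[0,+\infty)$ such that $\mu \mathrm{I}_d \preceq \nabla^2 U(z)\preceq L\mathrm{I}_d$ for all $z\in\mathbb{R}^d$; set $\kappa=L/\mu$. Let $\lambda_*$ be the minimizer of $\lambda\mapsto\mathcal{F}(q_\lambda)$ over $\Lambda$, let $\lambda_0\in\Lambda$ and $\Delta^2=\mu\|\lambda_0-\lambda_*\|_2^2$. Then there is an absolute constant $c>0$ such that for every $\epsilon>0$ there exist $t_*\ge0$ and $\tau\ge0$ for which the stochastic proximal gradient descent iterates $(\lambda_t)$ with the Bonnet–Price estimator, run with the step size schedule $\gamma_t=\gamma_0$ for $t<t_*$ and $\gamma_t=\frac1\mu\frac{2(t+\tau)+1}{(t+\tau+1)^2}$ for $t\ge t_*$, where $\gamma_0=1/(10L\kappa)$, satisfy: if $$T\ge c\Big(d\kappa\frac1\epsilon+\sqrt d\,\kappa^{3/2}\log(\kappa\Delta^2)\frac{1}{\sqrt\epsilon}+\kappa^2\log\Big(\Delta^2\frac1\epsilon\Big)\Big),$$ then $\mu\,\mathbb{E}[\mathrm{W}_2(q_{\lambda_T},q_{\lambda_*})^2]\le\epsilon$.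
   Context: For a probability measure $q$ with density, $\mathcal{E}(q)=\int U\,\mathrm{d}q$, $\mathcal{H}(q)=\int\log q(z)\,q(\mathrm{d}z)$, $\mathcal{F}=\mathcal{E}+\mathcal{H}$; $\mathrm{W}_2$ is the Wasserstein-2 distance. Let $\mathbb{L}^d$ denote lower-triangular $d\times d$ real matrices and $\mathbb{L}^d_{\succ0}$ those with strictly positive diagonal. Parameters are $\lambda=(m,C)$ with $m\in\mathbb{R}^d$, $C\in\mathbb{L}^d$, with Euclidean inner product $\langle (m,C),(m',C')\rangle=m^\top m'+\mathrm{tr}(C^\top C')$ and norm $\|\cdot\|_2$; $\Lambda=\{(m,C):C\in\mathbb{L}^d_{\succ0}\}$ and $q_\lambda=\mathrm{Normal}(m,CC^\top)$, i.e. $Z=C\epsilon+m$ with $\epsilon\sim\mathrm{Normal}(0_d,\mathrm{I}_d)$. For $A\in\mathbb{R}^{d\times d}$, $\mathrm{tril}(A)$ is its lower-triangular part. Bonnet–Price estimator: $\widehat g(\lambda;\epsilon)=(\nabla U(Z),\ \mathrm{tril}(\nabla^2U(Z)\,C))$ with $Z=C\epsilon+m$. Proximal operator: $\mathrm{prox}_{\gamma}(\lambda)=\arg\min_{\lambda'\in\Lambda}\{\gamma\mathcal{H}(q_{\lambda'})+\tfrac12\|\lambda'-\lambda\|_2^2\}$ (it keeps $m$ and off-diagonal entries and maps each diagonal entry $C_{ii}$ to $\tfrac12(C_{ii}+\sqrt{C_{ii}^2+4\gamma})$). SPGD: with $\epsilon_t\sim\mathrm{Normal}(0_d,\mathrm{I}_d)$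 i.i.d., $\lambda_{t+1/2}=\lambda_t-\gamma_t\widehat g(\lambda_t;\epsilon_t)$, $\lambda_{t+1}=\mathrm{prox}_{\gamma_t}(\lambda_{t+1/2})$. *)

(* Defs.v *)
From HB Require Import structures.
From mathcomp Require Import all_boot all_order all_algebra.
From mathcomp Require Import all_classical all_reals all_analysis.
Set Implicit Arguments. Unset Strict Implicit. Unset Printing Implicit Defensive.
Import Order.TTheory GRing.Theory Num.Theory.
Import numFieldNormedType.Exports.
Local Open Scope classical_set_scope.
Local Open Scope ring_scope.

Section SPGD.
Context {R : realType} {d : nat}.

Definition param := ('cV[R]_d * 'M[R]_d)%type.

Definition lower_tri (C : 'M[R]_d) : Prop := forall i j : 'I_d, (i < j)%N -> C i j = 0.

Definition Lambda (l : param) : Prop := lower_tri l.2 /\ (forall i, 0 < l.2 i i).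

Definition tril (A : 'M[R]_d) : 'M[R]_d := \matrix_(i, j) if (j <= i)%N then A i j else 0.

Definition param_sqnorm (l : param) : R :=
  \sum_(i < d) l.1 i 0 ^+ 2 + \sum_(i < d) \sum_(j < d) l.2 i j ^+ 2.

Definition param_sub (l l' : param) : param := (l.1 - l'.1, l.2 - l'.2).

Definition basis_vec (i : 'I_d) : 'cV[R]_d := delta_mx i 0.

Definition grad (U : 'cV[R]_d -> R) (z : 'cV[R]_d) : 'cV[R]_d :=
  \col_i ('D_(basis_vec i) U z).
Definition hess (U : 'cV[R]_d -> R) (z : 'cV[R]_d) : 'M[R]_d :=
  \matrix_(i, j) ('D_(basis_vec j) (grad U) z) i 0.

Definition twice_differentiable (U : 'cV[R]_d -> R) : Prop :=
  (forall z, differentiable U z) /\ (forall z, differentiable (grad U) z).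

Definition bonnet_price (U : 'cV[R]_d -> R) (l : param) (eps : 'cV[R]_d) : param :=
  let Z := l.2 *m eps + l.1 in (grad U Z, tril (hess U Z *m l.2)).

(* proximal operator of gamma * H over Lambda (closed form) *)
Definition prox (g : R) (l : param) : param :=
  (l.1, \matrix_(i, j) if i == j then (l.2 i i + Num.sqrt (l.2 i i ^+ 2 + 4 * g)) / 2
                        else l.2 i j).

Definition spgd_step (U : 'cV[R]_d -> R) (g : R) (l : param) (eps : 'cV[R]_d) : param :=
  let G := bonnet_price U l eps in prox g (l.1 - g *: G.1, l.2 - g *: G.2).

(* Integration against the standard Gaussian on R^n, written as iterated integrals
   against the one-dimensional standard normal law. *)
Fixpoint gauss_int (n : nat) (f : seq R -> \bar R) : \bar R :=
  match n with
  | 0 => f [::]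
  | n'.+1 => (\int[normal_prob 0 1]_x gauss_int n' (fun s => f (x :: s)))%E
  end.

Definition std_gauss_E (g : 'cV[R]_d -> \bar R) : \bar R :=
  gauss_int d (fun s => g (\col_i nth 0 s i)).

Definition gauss_pdf (l : param) (z : 'cV[R]_d) : R :=
  let S := l.2 *m l.2^T in
  (Num.sqrt (pi *+ 2) ^+ d)^-1 * (Num.sqrt (\det S))^-1 *
  expR (- ((z - l.1)^T *m invmx S *m (z - l.1)) 0 0 / 2).

Definition energy (U : 'cV[R]_d -> R) (l : param) : \bar R :=
  std_gauss_E (fun e => (U (l.2 *m e + l.1))%:E).

Definition entropy (l : param) : \bar R :=
  std_gauss_E (fun e => (ln (gauss_pdf l (l.2 *m e + l.1)))%:E).

Definition free_energy (U : 'cV[R]_d -> R) (l : param) : \bar R :=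
  (energy U l + entropy l)%E.

(* R^d as a measurable space: d-tuples of reals with the product sigma-algebra *)
Definition to_tuple (z : 'cV[R]_d) : d.-tuple R := [tuple z i 0 | i < d].

Definition q_law (l : param) (A : set (d.-tuple R)) : \bar R :=
  std_gauss_E (fun e => (\1_A (to_tuple (l.2 *m e + l.1)))%:E).

Definition coupling (p q : set (d.-tuple R) -> \bar R)
  (P : probability (d.-tuple R * d.-tuple R)%type R) : Prop :=
  forall A : set (d.-tuple R), measurable A ->
    P (A `*` setT) = p A /\ P (setT `*` A) = q A.

Definition W2sq (p q : set (d.-tuple R) -> \bar R) : \bar R :=
  ereal_inf [set c | exists P, coupling p q P /\
     c = (\int[P]_z (\sum_(i < d) (tnth z.1 i - tnth z.2 i) ^+ 2)%:E)%E].

(* E[ f(lambda_{t0+n}) ] for SPGD started at lambda_{t0} = l, with step sizes gam t,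
   the noises eps_t being i.i.d. Normal(0_d, I_d) *)
Fixpoint spgd_E (U : 'cV[R]_d -> R) (gam : nat -> R) (t n : nat) (l : param)
  (f : param -> \bar R) : \bar R :=
  match n with
  | 0 => f l
  | n'.+1 => std_gauss_E (fun e => spgd_E U gam t.+1 n' (spgd_step U (gam t) l e) f)
  end.

Definition schedule (mu L : R) (tstar : nat) (tau : R) (t : nat) : R :=
  if (t < tstar)%N then (10 * L * (L / mu))^-1
  else mu^-1 * ((2 * (t%:R + tau) + 1) / (t%:R + tau + 1) ^+ 2).

End SPGD.

(* Main.v *)
(** Write [lambda_s = (m_s, C_s)] for the minimizer.  Coupling [q_lambda] and [q_lambda_s] through
    the same noise bounds [W2^2] by [r = |lambda - lambda_s|^2], so it suffices to follow [r] along the iterates.  Put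
    [a = <grad E(lambda) - grad E(lambda_s), lambda - lambda_s> >= mu r].  Stein's identity makes
    the Bonnet-Price estimator unbiased and turns [E tr (C^T H C)] into [E <grad U(Z), C eps>].
    Optimality of [lambda_s], tested along lines in [Lambda], gives
    [E <grad U(Z_s), W eps + v> = sum_i W_ii / C_s_ii] for lower triangular [W].  Together with
    co-coercivity of [grad U] these identities bound the second moment of the estimator around
    [grad E(lambda_s)] by [6 L kappa a + 8 L d].  The proximal map is 1-Lipschitz and
    [lambda_s] is a fixed point of the exact proximal gradient step, so for
    [gamma <= 1 / (10 L kappa)]
    [E r' <= (1 - gamma mu) r + 8 gamma^2 L d].
    With [h = mu gamma] and [R = mu r] this reads [R' <= (1 - h) R + 8 h^2 kappa d]: it contracts
    geometrically for constant [h], and for [h = (2 s + 1) / (s + 1)^2] one has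
    [(s + 1)^2 R' <= s^2 R + 32 kappa d].  Starting the second phase at [s >= 20 kappa^2] once
    [R] has reached the noise level [d / kappa] yields the stated complexity. *)

Require Import Defs.
From HB Require Import structures.
From mathcomp Require Import all_boot all_order all_algebra.
From mathcomp Require Import all_classical all_reals all_analysis.
From mathcomp Require Import measurable_realfun ring lra.
Set Implicit Arguments. Unset Strict Implicit. Unset Printing Implicit Defensive.
Import Order.TTheory GRing.Theory Num.Theory.
Import numFieldNormedType.Exports.
Local Open Scope classical_set_scope.
Local Open Scope ring_scope.

(** * Stein's identity on the real line *)

(** The expectations in the statement are iterated one-dimensional integrals, and [W2sq] is not
    known to be measurable along the iterates. The induction over steps therefore uses only
    monotonicity of the integral on nonnegative functions: at each step the integrand is majorized
    by an affine function of [param_sqnorm], which can be integrated by Fubini. The Hessian is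
    assumed neither continuous nor symmetric. Stein's identity is thus proved for an everywhere
    defined, measurable and bounded derivative by means of difference quotients, and Hessian bounds
    are obtained as limits of gradient bounds. The Hessian block [H C] of the estimator scales with
    [C], not with [C - C_s], so its second moment cannot be compared with [r] directly. The
    inequality [|H C|^2 <= L tr (C^T H C)] reduces it to a quantity that Stein's identity turns into
    a pairing with the gradient. Finally, [ln (kappa * Delta2)] and [ln (Delta2 / eps)] may be
    negative, so the complexity bound is not a sum of nonnegative terms. This forces a case analysis
    in the scalar part and dictates the constant 1000. *)

Section normal1.
Context {R : realType}.
Local Notation mu := (@lebesgue_measure R).
Local Notation N01 := (normal_prob 0 1 : probability (measurableTypeR R) R).
Implicit Types f g h : R -> R.

(** [normal_prob] is dominated by Lebesgue measure, and its Radon-Nikodym derivative agrees almost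
    everywhere with [normal_pdf] because both have the same integral over every measurable set. *)
Lemma integral_normal_prob_ge0 (f : R -> \bar R) :
  measurable_fun setT f -> (forall x, (0 <= f x)%E) ->
  (\int[N01]_x f x = \int[mu]_x (f x * (normal_pdf 0 1 x)%:E))%E.
Proof.
move=> mf f0.
have dom : N01 `<< mu by exact: normal_prob_dominates.
rewrite -(Radon_Nikodym_SigmaFinite.change_of_variables dom)//.
have mp : measurable_fun setT (fun x : R => (normal_pdf 0 1 x)%:E).
  by apply/measurable_EFinP; exact: measurable_normal_pdf.
have iRN := Radon_Nikodym_SigmaFinite.f_integrable dom.
apply: ae_eq_integral => //.
- by apply: emeasurable_funM => //; exact: measurable_int iRN.
- exact: emeasurable_funM.
have : ae_eq mu setT (Radon_Nikodym_SigmaFinite.f N01 mu)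
    (fun x : R => (normal_pdf 0 1 x)%:E).
  apply: integral_ae_eq => // E _ mE.
  by rewrite -(Radon_Nikodym_SigmaFinite.f_integral dom).
by apply: filterS => x /= /[swap] _ /(_ I) ->.
Qed.

(** Multiplication by a nonnegative density commutes with taking positive and negative parts, so the
    identity holds even for non-integrable [f]. *)
Lemma integral_normal_prob f : measurable_fun setT f ->
  (\int[N01]_x (f x)%:E = \int[mu]_x (f x * normal_pdf 0 1 x)%:E)%E.
Proof.
move=> mf; have mEf : measurable_fun setT (EFin \o f) by exact/measurable_EFinP.
rewrite [LHS]integralE [RHS]integralE.
rewrite !integral_normal_prob_ge0//; [|exact: measurable_funeneg|exact: measurable_funepos].
congr (_ - _)%E; apply: eq_integral => x _;
  rewrite ?funeposE ?funenegE -?EFinN -?EFin_max -EFinM; congr EFin;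
  by rewrite maxr_pMl ?normal_pdf_ge0// mul0r ?mulNr.
Qed.

(** Lebesgue measure is determined by its values on half-open intervals, hence equals its
    pushforward under the shift; the rest is the pushforward formula. *)
Lemma integral_translate f (c : R) : mu.-integrable setT (EFin \o f) ->
  mu.-integrable setT (fun x => (f (x + c))%:E) /\
  (\int[mu]_x (f (x + c))%:E = \int[mu]_x (f x)%:E)%E.
Proof.
move=> intf.
have mphi : measurable_fun setT (fun x : measurableTypeR R => (x + c) : measurableTypeR R).
  exact: measurable_funD.
pose phi : {mfun measurableTypeR R >-> measurableTypeR R} :=
  HB.pack (fun x : measurableTypeR R => (x + c) : measurableTypeR R)
    (isMeasurableFun.Build _ _ _ _ _ mphi).
have E (A : set (measurableTypeR R)) : measurable A -> pushforward mu phi A = mu A.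
  move=> mA; apply/esym.
  apply: (@lebesgue_measure_unique R (pushforward mu phi)) => // _ [[a b]] _ <-.
  rewrite [RHS](_ : _ = mu `](a - c), (b - c)]%classic); last first.
    rewrite /= /pushforward; congr (mu _).
    by apply/seteqP; split => x /=; rewrite !in_itv/= ltrBlDr lerBrDr.
  rewrite !lebesgue_measure_itv/= !lte_fin ltrD2r.
  by case: ifP => // _; rewrite -!EFinD; congr EFin; ring.
have ip : (pushforward mu phi).-integrable setT (EFin \o f).
  move/integrableP: intf => [mf foo]; apply/integrableP; split => //.
  have -> : (\int[pushforward mu phi]_x `|(EFin \o f) x| = \int[mu]_x `|(EFin \o f) x|)%E.
    by apply: eq_measure_integral => A mA _; exact: E.
  exact: foo.
have mf := measurable_int _ intf.
have : mu.-integrable setT (fun x => (f (x + c))%:E).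
  apply/integrableP; split.
    exact: (measurableT_comp mf mphi).
  move/integrableP: ip => [_]; rewrite ge0_integral_pushforward//.
  exact: measurableT_comp.
move=> i1; split => //.
transitivity (\int[pushforward mu phi]_x (f x)%:E)%E; last first.
  by apply: eq_measure_integral => A mA _; exact: E.
by rewrite integral_pushforward.
Qed.

(** Up to normalization this is the normal density with standard deviation 2. It is flatter than the
    standard one, which leaves room for a quadratic factor and a unit shift. *)
Lemma integrable_expR_sqr : mu.-integrable setT (fun x => (expR (- x ^+ 2 / 8))%:E).
Proof.
have := @integrable_normal_pdf R 0 2.
move=> /(@integrableZl _ _ _ _ _ measurableT (normal_peak 2)^-1).
apply: eq_integrable => // x _; rewrite -EFinM normal_pdfE ?pnatr_eq0//.
rewrite mulKf ?gt_eqF ?normal_peak_gt0 ?pnatr_eq0//.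
by rewrite /normal_fun subr0; congr (expR (_ / _))%:E; ring.
Qed.

Lemma integrable_expR_sqr_dom f (C : R) : measurable_fun setT f ->
  (forall x, `|f x| <= C * expR (- x ^+ 2 / 8)) -> mu.-integrable setT (EFin \o f).
Proof.
move=> mf fC; have := integrable_expR_sqr.
move=> /(@integrableZl _ _ _ _ _ measurableT C).
apply: le_integrable => //; first exact/measurable_EFinP.
move=> x _; rewrite !abse_EFin/= lee_fin.
by rewrite (le_trans (fC x))// ler_norm.
Qed.

(* Deterioration of the Gaussian weight under a shift of size at most one, after absorbing a quadratic factor. *)
Lemma sqr_normal_pdf_le (x y : R) : 0 <= y - x <= 1 ->
  (1 + y ^+ 2) * normal_pdf 0 1 y <=
    4 * normal_peak 1 * expR (1 / 4) * expR (- x ^+ 2 / 8).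
Proof.
move=> xy; rewrite normal_pdfE ?oner_neq0// /normal_fun subr0.
have p0 := normal_peak_ge0 (1 : R).
have -> : - y ^+ 2 / (1 ^+ 2 *+ 2) = - (y ^+ 2 / 4) - y ^+ 2 / 4 by field.
rewrite expRD.
have h1 : 1 + y ^+ 2 <= 4 * expR (y ^+ 2 / 4).
  by have := expR_ge1Dx (y ^+ 2 / 4); lra.
have h2 : expR (- y ^+ 2 / 4) <= expR (1 / 4) * expR (- x ^+ 2 / 8).
  rewrite -expRD ler_expR; have := sqr_ge0 (2 * y - x); nra.
have h3 : expR (- (y ^+ 2 / 4)) * expR (y ^+ 2 / 4) = 1.
  by rewrite -expRD addNr expR0.
have e0 := expR_ge0 (- (y ^+ 2 / 4)).
rewrite mulNr in h2.
set a := expR (- (y ^+ 2 / 4)) in h2 h3 e0 *.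
set b := expR (y ^+ 2 / 4) in h1 h3.
have h4 : (1 + y ^+ 2) * a <= 4 by nra.
have -> : (1 + y ^+ 2) * (normal_peak 1 * (a * a)) = normal_peak 1 * (((1 + y ^+ 2) * a) * a) by ring.
have -> : 4 * normal_peak 1 * expR (1 / 4) * expR (- x ^+ 2 / 8)
  = normal_peak 1 * (4 * (expR (1 / 4) * expR (- x ^+ 2 / 8))) by ring.
rewrite ler_wpM2l//.
apply: (@le_trans _ _ (4 * a)); first by rewrite ler_wpM2r.
by rewrite ler_wpM2l.
Qed.

Definition quad_growth1 f := measurable_fun setT f /\
  exists K, forall x, `|f x| <= K * (1 + x ^+ 2).

Lemma quad_growth1_integrable_mul f : quad_growth1 f ->
  mu.-integrable setT (fun x => (f x * normal_pdf 0 1 x)%:E).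
Proof.
move=> [mf [K fK]].
apply: (@integrable_expR_sqr_dom _ (`|K| * (4 * normal_peak 1 * expR (1 / 4)))).
  by apply: measurable_funM => //; exact: measurable_normal_pdf.
move=> x; rewrite normrM (ger0_norm (normal_pdf_ge0 _ _ _)).
have h := @sqr_normal_pdf_le x x; rewrite subrr lexx ler01 in h.
apply: (@le_trans _ _ (`|K| * ((1 + x ^+ 2) * normal_pdf 0 1 x))).
  rewrite mulrA ler_wpM2r ?normal_pdf_ge0//; apply: (le_trans (fK x)).
  by rewrite ler_wpM2r ?ler_norm// addr_ge0 ?sqr_ge0.
by rewrite -[leRHS]mulrA ler_wpM2l ?normr_ge0// h.
Qed.

Lemma quad_growth1_integrable f : quad_growth1 f ->
  N01.-integrable setT (EFin \o f).
Proof.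
move=> qf; have [mf _] := qf; apply/integrableP; split; first exact/measurable_EFinP.
rewrite integral_normal_prob_ge0//; last first.
  by apply: measurableT_comp => //; exact/measurable_EFinP.
move/integrableP: (quad_growth1_integrable_mul qf) => [_].
congr (_ < _)%E; apply: eq_integral => x _ /=.
by rewrite normrM EFinM (ger0_norm (normal_pdf_ge0 _ _ _)).
Qed.

Lemma is_derive_normal_pdf (x : R) :
  is_derive x 1 (normal_pdf (0 : R) 1) (- x * normal_pdf 0 1 x).
Proof.
rewrite normal_pdfE ?oner_neq0//.
have d1 : is_derive x 1 (fun y : R => - (y - 0) ^+ 2 / (1 ^+ 2 *+ 2)) (- x).
  apply: is_derive_eq.
  by rewrite !subr0 /GRing.scale/= expr1n; lra.
have := @is_derive1_comp R expR _ x _ _ (is_derive_expR _) d1.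
move=> /(@is_deriveM R R (cst (normal_peak (1:R))) _ x 1 0 _ (is_derive_cst _ _ _)).
move=> /is_derive_eq; apply.
rewrite /= scaler0 addr0 /GRing.scale/= /normal_fun.
ring.
Qed.

(** Sequential form of the derivative, along the increments [n.+1%:R^-1], suited to dominated
    convergence and to measurability of pointwise limits. *)
Lemma quotient_cvg h (dh x : R) : is_derive x 1 h dh ->
  (fun n : nat => n.+1%:R * (h (x + n.+1%:R^-1) - h x)) @ \oo --> dh.
Proof.
move=> [dhx <-].
have c0 : (fun n : nat => n.+1%:R^-1 : R) @ \oo --> (0 : R)^'.
  move=> A /= A0.
  have A0' : \forall y \near (0:R), y != 0 -> A y by exact: A0.
  have : \forall n \near \oo, (n.+1%:R^-1 : R) != 0 -> A (n.+1%:R^-1).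
    exact: (@cvg_harmonic R _ A0').
  move=> Ah; change (\forall n \near \oo, A (n.+1%:R^-1)).
  by apply: filterS Ah => n; apply; rewrite invr_eq0 pnatr_eq0.
have := cvg_comp _ _ c0 dhx.
apply: cvg_trans; apply: near_eq_cvg; apply: nearW => n /=.
by rewrite invrK /GRing.scale/= mulr1 [x + _]addrC.
Qed.

Lemma lipschitz_growth h (dh : R -> R) (K : R) : (forall x : R, is_derive x 1 h (dh x)) ->
  (forall x, `|dh x| <= K) -> forall x y, `|h y - h x| <= K * `|y - x|.
Proof.
move=> dhx dK.
have ch : continuous h.
  by move=> x; apply: differentiable_continuous; apply/derivable1_diffP; case: (dhx x).
have main x y : x < y -> `|h y - h x| <= K * `|y - x|.
  move=> xy; have [c _ ->] := MVT xy (fun z _ => dhx z) (continuous_subspaceT ch).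
  by rewrite normrM ler_wpM2r.
move=> x y; have [xy|yx|->] := ltgtP x y; first exact: main.
- by rewrite distrC [`|y - x|]distrC main.
- by rewrite !subrr normr0 mulr0.
Qed.

Lemma quad_growth1D f g : quad_growth1 f -> quad_growth1 g ->
  quad_growth1 (fun x => f x + g x).
Proof.
move=> [mf [K fK]] [mg [L gL]]; split; first exact: measurable_funD.
exists (K + L) => x; rewrite mulrDl.
by rewrite (le_trans (ler_normD _ _))// lerD.
Qed.

Lemma quad_growth1N f : quad_growth1 f -> quad_growth1 (fun x => - f x).
Proof.
move=> [mf [K fK]]; split; first exact: measurableT_comp.
by exists K => x; rewrite normrN.
Qed.

(** Each difference quotient of [h] integrates to zero by translation invariance, and dominated
    convergence passes to the derivative. This replaces the fundamental theorem of calculus, since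
    [dh] is only measurable. The last bound ranges over [y] in [[x, x + 1]] because the quotient at
    [x] equals [dh] at a mean-value point of that interval. *)
Lemma integral_quotient h (dh : R -> R) (C : R) :
  (forall x : R, is_derive x 1 h (dh x)) -> measurable_fun setT dh ->
  (forall x, `|h x| <= C * expR (- x ^+ 2 / 8)) ->
  (forall x y, 0 <= y - x <= 1 -> `|dh y| <= C * expR (- x ^+ 2 / 8)) ->
  (\int[mu]_x (dh x)%:E = 0)%E.
Proof.
move=> dhx mdh hC dC.
have ch : continuous h.
  by move=> x; apply: differentiable_continuous; apply/derivable1_diffP; case: (dhx x).
have mh : measurable_fun setT h by exact: continuous_measurable_fun.
have ih : mu.-integrable setT (EFin \o h) by exact: integrable_expR_sqr_dom hC.
have mhn (n : nat) : measurable_fun setT (fun x : R => h (x + n.+1%:R^-1)).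
  by apply: measurableT_comp => //; exact: measurable_funD.
pose q (n : nat) (x : R) := n.+1%:R * (h (x + n.+1%:R^-1) - h x).
have mq n : measurable_fun setT (q n).
  by apply: measurable_funM => //; exact: measurable_funB.
have [|||||_ _] := @dominated_convergence _ _ R mu setT measurableT
  (fun n x => (q n x)%:E) (fun x => (dh x)%:E) (fun x => C%:E * (expR (- x ^+ 2 / 8))%:E)%E.
- by move=> n; apply/measurable_EFinP; exact: mq.
- by apply/measurable_EFinP.
- by apply: aeW => x _; apply: cvg_EFin; [exact: nearW|exact: quotient_cvg].
- exact: integrableZl integrable_expR_sqr.
- apply: aeW => x n _; rewrite abse_EFin -EFinM lee_fin.
  have n0 : (0 : R) < n.+1%:R^-1 by rewrite invr_gt0.
  have xn : x < x + n.+1%:R^-1 by rewrite ltrDl.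
  have [c + e] := MVT xn (fun z _ => dhx z) (continuous_subspaceT ch).
  rewrite /q e.
  rewrite in_itv/= => /andP[xc cx]; rewrite addrAC subrr add0r mulrC divfK ?pnatr_eq0//.
  apply: dC; rewrite subr_ge0 ltW//= lerBlDl (le_trans (ltW cx))// lerD2l.
  by rewrite invf_le1// ler1n.
have -> : [sequence (\int[mu]_x (q n x)%:E)%E]_n = cst 0%E.
  apply/funext => n /=; have [i1 e1] := integral_translate n.+1%:R^-1 ih.
  under eq_integral do rewrite EFinM.
  rewrite integralZl//; last first.
    by under eq_fun do rewrite EFinB; exact: integrableB.
  under eq_integral do rewrite EFinB.
  rewrite integralB// e1 subee ?mule0//.
  exact: integrable_fin_num.
by move=> /(cvg_unique _ (cvg_cst _))->.
Qed.

Lemma quad_growth1_lipschitz g (dg : R -> R) (K : R) :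
  (forall x : R, is_derive x 1 g (dg x)) -> measurable_fun setT dg ->
  (forall x, `|dg x| <= K) ->
  [/\ quad_growth1 dg, quad_growth1 g & quad_growth1 (fun x => x * g x)].
Proof.
move=> dgx mdg dK.
have K0 : 0 <= K by exact: le_trans (dK 0).
have gK x : `|g x| <= `|g 0| + K * `|x|.
  have := lipschitz_growth dgx dK 0 x; rewrite subr0.
  have -> : g x = g 0 + (g x - g 0) by ring.
  by have := ler_normD (g 0) (g x - g 0); rewrite addrAC subrr add0r; lra.
have mg : measurable_fun setT g.
  apply: continuous_measurable_fun => x.
  by apply: differentiable_continuous; apply/derivable1_diffP; case: (dgx x).
split.
- split => //; exists K => x; rewrite (le_trans (dK x))// mulrDr mulr1 lerDl.
  by rewrite mulr_ge0 ?sqr_ge0.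
- split => //; exists (`|g 0| + K) => x; rewrite (le_trans (gK x))//.
  have := normr_ge0 (g 0); have := normr_ge0 x; rewrite -[x ^+ 2]real_normK ?num_real//.
  by set a := `|x|; set b := `|g 0|; have := sqr_ge0 (a - 1); nra.
- split; first exact: measurable_funM.
  exists (`|g 0| + K) => x; rewrite normrM.
  apply: (@le_trans _ _ (`|x| * (`|g 0| + K * `|x|))); first by rewrite ler_wpM2l.
  have := normr_ge0 (g 0); have := normr_ge0 x; rewrite -[x ^+ 2]real_normK ?num_real//.
  by set a := `|x|; set b := `|g 0|; have := sqr_ge0 (a - 1); nra.
Qed.

(** The function [g x * normal_pdf 0 1 x] has derivative [(dg x - x * g x) * normal_pdf 0 1 x],
    whose integral vanishes by [integral_quotient]. *)
Lemma stein1 g (dg : R -> R) (K : R) :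
  (forall x : R, is_derive x 1 g (dg x)) -> measurable_fun setT dg ->
  (forall x, `|dg x| <= K) ->
  (\int[N01]_x (dg x)%:E = \int[N01]_x (x * g x)%:E)%E.
Proof.
move=> dgx mdg dK.
have [qdg qg qxg] := quad_growth1_lipschitz dgx mdg dK.
have qd := quad_growth1D qdg (quad_growth1N qxg).
have [mf _] := qd; have [_ [A hA]] := qd; have [_ [B hB]] := qg.
have [mxg _] := qxg.
(* A common envelope for that product and its derivative: [A] and [B] are the quadratic-growth
   constants of [dg x - x * g x] and of [g]. *)
pose C := (`|A| + `|B|) * (4 * normal_peak (1 : R) * expR (1 / 4)).
have bnd (a M x y : R) : `|a| <= M * (1 + y ^+ 2) -> 0 <= y - x <= 1 -> `|M| <= `|A| + `|B| ->
    `|a * normal_pdf 0 1 y| <= C * expR (- x ^+ 2 / 8).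
  move=> aM yx MAB; rewrite normrM (ger0_norm (normal_pdf_ge0 _ _ _)).
  apply: (@le_trans _ _ ((`|A| + `|B|) * ((1 + y ^+ 2) * normal_pdf 0 1 y))).
    rewrite mulrA ler_wpM2r ?normal_pdf_ge0// (le_trans aM)//.
    by rewrite ler_wpM2r ?addr_ge0 ?sqr_ge0// (le_trans (ler_norm _)).
  by rewrite -[leRHS]mulrA ler_wpM2l ?addr_ge0// sqr_normal_pdf_le.
have : (\int[mu]_x ((dg x + - (x * g x)) * normal_pdf 0 1 x)%:E = 0)%E.
  apply: (@integral_quotient (fun x => g x * normal_pdf 0 1 x) _ C).
  - move=> x; have := is_deriveM (dgx x) (is_derive_normal_pdf x).
    move=> /is_derive_eq; apply; rewrite /GRing.scale/=; ring.
  - by apply: measurable_funM => //; exact: measurable_normal_pdf.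
  - by move=> x; apply: bnd (hB x) _ _; rewrite ?subrr ?lexx ?ler01// lerDr.
  - by move=> x y xy; apply: bnd (hA y) xy _; rewrite lerDl.
have i1 := quad_growth1_integrable_mul qdg; have i2 := quad_growth1_integrable_mul qxg.
under eq_integral do rewrite mulrDl mulNr EFinB.
rewrite integralB// -!integral_normal_prob// => /eqP; rewrite sube_eq ?add0e; last 2 first.
- exact: integrable_fin_num (quad_growth1_integrable qdg).
- by rewrite fin_num_adde_defr.
by move=> /eqP.
Qed.

End normal1.

(** * The standard Gaussian measure on tuples *)

Section prodP.
Context d1 d2 (T1 : measurableType d1) (T2 : measurableType d2) (R : realType).
Variables (P1 : probability T1 R) (P2 : probability T2 R).

Definition product_prob := (P1 \x P2)%E.

HB.instance Definition _ := Measure.on product_prob.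

Lemma product_prob_setT : product_prob setT = 1%E.
Proof.
rewrite /product_prob -setXTT; transitivity (P1 setT * P2 setT)%E.
  exact: product_measure1E.
by rewrite !probability_setT mule1.
Qed.

HB.instance Definition _ := Measure_isProbability.Build _ _ _ product_prob product_prob_setT.

End prodP.

Section gauss_tuple.
Context {R : realType}.
Local Notation N01 := (normal_prob 0 1 : probability (measurableTypeR R) R).
Local Notation rT := (measurableTypeR R).

Definition tcons n (p : rT * n.-tuple rT) : n.+1.-tuple rT := [the n.+1.-tuple _ of p.1 :: p.2].

Lemma measurable_tcons n : measurable_fun setT (@tcons n).
Proof. exact: measurable_cons. Qed.

HB.instance Definition _ n := isMeasurableFun.Build _ _ _ _ (@tcons n) (@measurable_tcons n).

(** Built by the same recursion as [gauss_int], head coordinate outermost, so that Fubini identifies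
    the two level by level. *)
Fixpoint gauss_tuple n : probability (n.-tuple rT) R :=
  match n with
  | 0 => dirac [tuple]
  | n'.+1 => distribution (product_prob N01 (gauss_tuple n')) (@tcons n')
  end.

Lemma gauss_tuple0 (f : 0.-tuple rT -> \bar R) : measurable_fun setT f ->
  (\int[gauss_tuple 0]_t f t = f [tuple])%E.
Proof. by move=> mf; rewrite /= integral_dirac// diracE in_setT mul1e. Qed.

Lemma gauss_tupleS_ge0 n (f : n.+1.-tuple rT -> \bar R) : measurable_fun setT f ->
  (forall t, 0 <= f t)%E ->
  (\int[gauss_tuple n.+1]_t f t = \int[N01]_x \int[gauss_tuple n]_t f (tcons (x, t)))%E.
Proof.
move=> mf f0; rewrite [LHS]ge0_integral_distribution//.
apply: (fubini_tonelli1 (f \o @tcons n)).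
- exact: measurableT_comp.
- by move=> x; exact: f0.
Qed.

Definition sqnorm n (t : n.-tuple rT) : R := \sum_(i < n) tnth t i ^+ 2.

Lemma sqnorm_ge0 n (t : n.-tuple rT) : 0 <= sqnorm t.
Proof. by apply: sumr_ge0 => i _; exact: sqr_ge0. Qed.

Lemma sqnorm_tcons n x (t : n.-tuple rT) : sqnorm (tcons (x, t)) = x ^+ 2 + sqnorm t.
Proof.
rewrite /sqnorm big_ord_recl; congr (_ + _).
by apply: eq_bigr => i _; rewrite /tcons /= tnthS.
Qed.

Lemma measurable_sqnorm n : measurable_fun setT (@sqnorm n).
Proof.
apply: measurable_sum => i.
by apply: measurable_funX; exact: measurable_tnth.
Qed.

(** A class of Gaussian-integrable functions closed under linear combinations and under fixing the
    head. It contains the potential along affine maps and the products of two functions of linear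
    growth. *)
Definition quad_growth n (f : n.-tuple rT -> R) := measurable_fun setT f /\
  exists K, forall t, `|f t| <= K * (1 + sqnorm t).

Lemma quad_growth1_sqr (c : R) : quad_growth1 (fun x : R => c + x ^+ 2).
Proof.
split.
  by apply: measurable_funD => //; exact: measurable_funX.
exists (`|c| + 1) => x; rewrite (le_trans (ler_normD _ _))//.
rewrite (ger0_norm (sqr_ge0 x)); have := normr_ge0 c; have := sqr_ge0 x; nra.
Qed.

(** Induction on the dimension by Tonelli: integrating out the tail leaves a constant plus [x ^+ 2],
    which is integrable in one variable. *)
Lemma sqnorm_integrable n : (gauss_tuple n).-integrable setT (fun t => (1 + sqnorm t)%:E).
Proof.
have m n' : measurable_fun setT (fun t : n'.-tuple rT => (1 + sqnorm t)%:E).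
  by apply/measurable_EFinP; apply: measurable_funD => //; exact: measurable_sqnorm.
have p n' (t : n'.-tuple rT) : (0 <= (1 + sqnorm t)%:E)%E.
  by rewrite lee_fin addr_ge0// sqnorm_ge0.
apply/integrableP; split; first exact: m.
under eq_integral => t _ do rewrite gee0_abs//.
elim: n => [|n IH].
  by rewrite gauss_tuple0// ltry.
rewrite (gauss_tupleS_ge0 (m _) (p _)).
have Ie : (\int[gauss_tuple n]_t (1 + sqnorm t)%:E)%E \is a fin_num.
  by rewrite ge0_fin_numE// integral_ge0.
set I := (\int[gauss_tuple n]_t (1 + sqnorm t)%:E)%E in Ie IH *.
have I0 : 0 <= fine I by rewrite fine_ge0// integral_ge0.
have -> : (\int[N01]_x \int[gauss_tuple n]_t (1 + sqnorm (tcons (x, t)))%:E =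
    \int[N01]_x (fine I + x ^+ 2)%:E)%E.
  apply: eq_integral => x _.
  under eq_integral => t _ do rewrite sqnorm_tcons addrCA addrC EFinD.
  rewrite ge0_integralD//=.
  - by rewrite integral_cst//= probability_setT mule1 EFinD fineK.
  - exact: m.
  - by move=> t _; rewrite lee_fin sqr_ge0.
have [mq _] := quad_growth1_sqr (fine I).
have /integrableP[_] := quad_growth1_integrable (quad_growth1_sqr (fine I)).
apply: le_lt_trans; apply: ge0_le_integral => //=.
- by move=> x _; rewrite lee_fin addr_ge0 ?sqr_ge0.
- exact/measurable_EFinP.
- by apply/measurable_EFinP; apply: measurableT_comp.
- by move=> x _; rewrite lee_fin ler_norm.
Qed.

Lemma quad_growth_integrable n (f : n.-tuple rT -> R) : quad_growth f ->
  (gauss_tuple n).-integrable setT (EFin \o f).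
Proof.
move=> [mf [K fK]].
have := @integrableZl _ _ _ _ _ measurableT K _ (sqnorm_integrable n).
apply: le_integrable => //; first exact/measurable_EFinP.
by move=> t _; rewrite -EFinM !abse_EFin/= lee_fin (le_trans (fK t))// ler_norm.
Qed.

Lemma measurable_tcons_r n (x : R) : measurable_fun setT (fun t : n.-tuple rT => tcons (x, t)).
Proof. by apply: (@measurable_cons _ _ _ _ (cst x) _ id); [exact: measurable_cst|exact: measurable_id]. Qed.

Lemma quad_growth_slice n (f : n.+1.-tuple rT -> R) x : quad_growth f ->
  quad_growth (fun t => f (tcons (x, t))).
Proof.
move=> [mf [K fK]]; split.
  exact: (measurableT_comp mf (measurable_tcons_r _)).
exists (`|K| * (1 + x ^+ 2)) => t; rewrite (le_trans (fK _))// sqnorm_tcons.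
have := ler_norm K; have := normr_ge0 K; have := sqr_ge0 x; have := sqnorm_ge0 t.
set a := sqnorm t; set b := x ^+ 2; set k := `|K| => a0 b0 k0 Kk.
apply: (@le_trans _ _ (k * (1 + (b + a)))).
  by rewrite ler_wpM2r ?addr_ge0.
by rewrite -mulrA ler_wpM2l//; nra.
Qed.

Lemma quad_growth_prod n (f : n.+1.-tuple rT -> R) : quad_growth f ->
  (N01 \x gauss_tuple n)%E.-integrable setT (EFin \o f \o @tcons n).
Proof.
move=> qf; have [mf _] := qf.
have /integrableP[_ foo] := quad_growth_integrable qf.
apply/integrableP; split.
  by do 2 apply: measurableT_comp => //.
rewrite ge0_integral_distribution in foo => //.
by do 2 apply: measurableT_comp => //.
Qed.

Lemma gauss_tupleS n (f : n.+1.-tuple rT -> R) : quad_growth f ->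
  (\int[gauss_tuple n.+1]_t (f t)%:E = \int[N01]_x \int[gauss_tuple n]_t (f (tcons (x, t)))%:E)%E.
Proof.
move=> qf; have [mf _] := qf; have i := quad_growth_prod qf.
rewrite [LHS](@integral_distribution _ _ _ _ _ (product_prob N01 (gauss_tuple n)) (@tcons n) (EFin \o f))//.
  by rewrite -(integral12_prod_meas1 i).
exact/measurable_EFinP.
Qed.

Lemma gauss_tupleS_swap n (f : n.+1.-tuple rT -> R) : quad_growth f ->
  (\int[gauss_tuple n.+1]_t (f t)%:E = \int[gauss_tuple n]_t \int[N01]_x (f (tcons (x, t)))%:E)%E.
Proof.
move=> qf; rewrite gauss_tupleS//; have i := quad_growth_prod qf.
exact: (Fubini i).
Qed.

Definition set_tnth n (t : n.-tuple rT) (j : 'I_n) (x : R) : n.-tuple rT :=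
  [tuple if i == j then x else tnth t i | i < n].

(** Fubini with the coordinate [j] innermost. If [j] is the head, the order of integration is
    swapped; otherwise the head is frozen and the induction hypothesis applies to the slices. *)
Lemma gauss_tuple_coord n (j : 'I_n) (F G : n.-tuple rT -> R) :
  quad_growth F -> quad_growth G ->
  (forall t, \int[N01]_x (F (set_tnth t j x))%:E = \int[N01]_x (G (set_tnth t j x))%:E)%E ->
  (\int[gauss_tuple n]_t (F t)%:E = \int[gauss_tuple n]_t (G t)%:E)%E.
Proof.
elim: n j F G => [[]//|n IH j F G qF qG FG].
have [j0|[j' jj']] : (j = ord0) \/ exists j', j = lift ord0 j'.
  by case: (unliftP ord0 j) => [j' ->|->]; [right; exists j'|left].
- rewrite !gauss_tupleS_swap//; apply: eq_integral => t _.
  (* The dummy head [0] is overwritten by [set_tnth]. *)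
  have e x : tcons (x, t) = set_tnth (tcons (0, t)) j x.
    apply: eq_from_tnth => i; rewrite tnth_mktuple j0.
    case: (unliftP ord0 i) => [i' ->|->//].
    by rewrite /tcons /= !tnthS.
  by under eq_integral do rewrite e; rewrite FG; under eq_integral do rewrite -e.
- rewrite !gauss_tupleS//; apply: eq_integral => x _.
  apply: (IH j'); [exact: quad_growth_slice..|] => t.
  have e y : tcons (x, set_tnth t j' y) = set_tnth (tcons (x, t)) j y.
    apply: eq_from_tnth => i; rewrite tnth_mktuple jj'.
    case: (unliftP ord0 i) => [i' ->|->//].
    by rewrite /tcons /= !tnthS tnth_mktuple (inj_eq lift_inj).
  by under eq_integral do rewrite e; rewrite FG; under eq_integral do rewrite -e.
Qed.

End gauss_tuple.

(** * Expectations under the iterated Gaussian integral *)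

Section gauss_expectation.
Context {R : realType}.
Local Notation N01 := (normal_prob 0 1 : probability (measurableTypeR R) R).
Local Notation rT := (measurableTypeR R).

(* No measurability is assumed: the expectations in [spgd_E] involve [W2sq], whose measurability is unclear. *)
Lemma le_integral_ge0_nomeas d (T : measurableType d) (P : probability T R) (f g : T -> \bar R) :
  (forall x, 0 <= f x)%E -> (forall x, f x <= g x)%E ->
  (\int[P]_x f x <= \int[P]_x g x)%E.
Proof.
move=> f0 fg; have g0 x : (0 <= g x)%E by exact: le_trans (f0 x) (fg x).
rewrite !ge0_integralTE//; apply: ereal_sup_le => _ [h hf <-].
by exists h => // x; exact: le_trans (hf x) (fg x).
Qed.

Lemma gauss_int_ge0 n (F : seq R -> \bar R) :
  (forall s, 0 <= F s)%E -> (0 <= gauss_int n F)%E.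
Proof.
elim: n F => [|n IH] F F0 /=; first exact: F0.
apply: (@integral_ge0 _ _ R N01) => x _; exact: IH.
Qed.

Lemma gauss_int_le n (F G : seq R -> \bar R) :
  (forall s, 0 <= F s)%E -> (forall s, F s <= G s)%E ->
  (gauss_int n F <= gauss_int n G)%E.
Proof.
elim: n F G => [|n IH] F G F0 FG /=; first exact: FG.
apply: le_integral_ge0_nomeas => x.
- exact: gauss_int_ge0.
- exact: IH.
Qed.

Lemma gauss_int_ge0E n (F : seq R -> \bar R) :
  measurable_fun setT (fun t : n.-tuple rT => F (val t)) ->
  (forall s, 0 <= F s)%E ->
  (gauss_int n F = \int[gauss_tuple n]_t F (val t))%E.
Proof.
elim: n F => [|n IH] F mF F0 /=; first by rewrite (@gauss_tuple0 R (fun t => F (val t))).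
rewrite -[RHS]/(\int[gauss_tuple n.+1]_t F (val t))%E.
rewrite (@gauss_tupleS_ge0 R n (fun t => F (val t)))//.
apply: eq_integral => x _; apply: IH => //.
exact: (measurableT_comp mF (measurable_tcons_r x)).
Qed.

(** Quadratic growth survives fixing the head, so Fubini applies at every level of the iterated
    integral. *)
Lemma gauss_int_quad n (F : seq R -> R) :
  quad_growth (fun t : n.-tuple rT => F (val t)) ->
  (gauss_int n (fun s => (F s)%:E) = \int[gauss_tuple n]_t (F (val t))%:E)%E.
Proof.
elim: n F => [|n IH] F qF /=.
  rewrite (@gauss_tuple0 R (fun t => (F (val t))%:E))//.
  by have [mF _] := qF; exact/measurable_EFinP.
rewrite -[RHS]/(\int[gauss_tuple n.+1]_t (F (val t))%:E)%E (gauss_tupleS qF).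
apply: eq_integral => x _; apply: IH.
exact: (quad_growth_slice x qF).
Qed.

(** Real-valued, so that real arithmetic applies; it agrees with the extended integral on integrands
    of quadratic growth, by [gaussE_EFin]. *)
Definition gaussE n (f : n.-tuple rT -> R) : R := Rintegral (gauss_tuple n) setT f.

Section gaussE.
Context {n : nat}.
Implicit Types f g : n.-tuple rT -> R.

Lemma gaussE_EFin f : quad_growth f -> (\int[gauss_tuple n]_t (f t)%:E = (gaussE f)%:E)%E.
Proof.
move=> qf; rewrite /gaussE /Rintegral fineK//.
exact: integrable_fin_num (quad_growth_integrable qf).
Qed.

Lemma quad_growthD f g : quad_growth f -> quad_growth g -> quad_growth (fun t => f t + g t).
Proof.
move=> [mf [K fK]] [mg [L gL]]; split; first exact: measurable_funD.
by exists (K + L) => x; rewrite mulrDl (le_trans (ler_normD _ _))// lerD.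
Qed.

Lemma quad_growthZ c f : quad_growth f -> quad_growth (fun t => c * f t).
Proof.
move=> [mf [K fK]]; split; first exact: measurable_funM.
by exists (`|c| * K) => x; rewrite normrM -mulrA ler_wpM2l.
Qed.

Lemma quad_growthN f : quad_growth f -> quad_growth (fun t => - f t).
Proof.
move=> [mf [K fK]]; split; first exact: measurableT_comp.
by exists K => x; rewrite normrN.
Qed.

Lemma quad_growthB f g : quad_growth f -> quad_growth g -> quad_growth (fun t => f t - g t).
Proof. by move=> qf qg; apply: quad_growthD => //; exact: quad_growthN. Qed.

Lemma quad_growth_cst c : quad_growth (fun _ : n.-tuple rT => c).
Proof.
split; first exact: measurable_cst.
by exists `|c| => t; rewrite ler_peMr// lerDl sqnorm_ge0.
Qed.

Lemma quad_growth_sum (I : Type) (r : seq I) (F : I -> n.-tuple rT -> R) :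
  (forall i, quad_growth (F i)) -> quad_growth (fun t => \sum_(i <- r) F i t).
Proof.
move=> qF; elim: r => [|i r IH].
  by under eq_fun do rewrite big_nil; exact: quad_growth_cst.
by under eq_fun do rewrite big_cons; exact: quad_growthD.
Qed.

Lemma gaussE_D f g : quad_growth f -> quad_growth g -> gaussE (fun t => f t + g t) = gaussE f + gaussE g.
Proof. by move=> qf qg; rewrite /gaussE RintegralD//; exact: quad_growth_integrable. Qed.

Lemma gaussE_Z c f : quad_growth f -> gaussE (fun t => c * f t) = c * gaussE f.
Proof. by move=> qf; rewrite /gaussE RintegralZl//; exact: quad_growth_integrable. Qed.

Lemma gaussE_B f g : quad_growth f -> quad_growth g -> gaussE (fun t => f t - g t) = gaussE f - gaussE g.
Proof. by move=> qf qg; rewrite /gaussE RintegralB//; exact: quad_growth_integrable. Qed.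

Lemma gaussE_cst c : gaussE (fun _ : n.-tuple rT => c) = c.
Proof. by rewrite /gaussE Rintegral_cst//= probability_setT mulr1. Qed.

Lemma gaussE_sum (I : Type) (r : seq I) (F : I -> n.-tuple rT -> R) :
  (forall i, quad_growth (F i)) -> gaussE (fun t => \sum_(i <- r) F i t) = \sum_(i <- r) gaussE (F i).
Proof.
move=> qF; elim: r => [|i r IH].
  by under [in LHS]eq_fun do rewrite big_nil; rewrite big_nil gaussE_cst.
rewrite big_cons -IH -gaussE_D//; last exact: quad_growth_sum.
by congr gaussE; apply/funext => t; rewrite big_cons.
Qed.

Lemma gaussE_le f g : quad_growth f -> quad_growth g -> (forall t, f t <= g t) -> gaussE f <= gaussE g.
Proof. by move=> qf qg fg; rewrite /gaussE le_Rintegral//; exact: quad_growth_integrable. Qed.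

(** The bound is put on the square so that estimates of dot products feed into it without square
    roots. *)
Definition lin_growth f := measurable_fun setT f /\
  exists K, forall t, f t ^+ 2 <= K * (1 + sqnorm t).

Lemma lin_growth_mul f g : lin_growth f -> lin_growth g -> quad_growth (fun t => f t * g t).
Proof.
move=> [mf [K fK]] [mg [L gL]]; split; first exact: measurable_funM.
exists (K + L) => t; have := fK t; have := gL t; rewrite mulrDl normrM.
rewrite -[f t ^+ 2]real_normK ?num_real// -[g t ^+ 2]real_normK ?num_real//.
set a := `|f t|; set b := `|g t|; have := sqr_ge0 (a - b); have := sqr_ge0 a; have := sqr_ge0 b.
by nra.
Qed.

Lemma lin_growthD f g : lin_growth f -> lin_growth g -> lin_growth (fun t => f t + g t).
Proof.
move=> [mf [K fK]] [mg [L gL]]; split; first exact: measurable_funD.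
exists (2 * (K + L)) => t; have := fK t; have := gL t; have := sqr_ge0 (f t - g t).
by nra.
Qed.

Lemma lin_growthZ c f : lin_growth f -> lin_growth (fun t => c * f t).
Proof.
move=> [mf [K fK]]; split; first exact: measurable_funM.
by exists (c ^+ 2 * K) => t; rewrite exprMn -mulrA ler_wpM2l// sqr_ge0.
Qed.

Lemma lin_growthN f : lin_growth f -> lin_growth (fun t => - f t).
Proof.
move=> [mf [K fK]]; split; first exact: measurableT_comp.
by exists K => t; rewrite sqrrN.
Qed.

Lemma lin_growth_bounded f (K : R) : measurable_fun setT f -> (forall t, f t ^+ 2 <= K) ->
  lin_growth f.
Proof.
move=> mf fK; split => //; exists `|K| => t.
by rewrite (le_trans (fK t))// (le_trans (ler_norm _))// ler_peMr// lerDl sqnorm_ge0.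
Qed.

Lemma lin_growth_cst c : lin_growth (fun _ : n.-tuple rT => c).
Proof. by apply: (@lin_growth_bounded _ (c ^+ 2)) => //; exact: measurable_cst. Qed.

Lemma lin_growth_tnth i : lin_growth (fun t : n.-tuple rT => tnth t i : R).
Proof.
split; first exact: measurable_tnth.
exists 1 => t; rewrite mul1r /sqnorm (bigD1 i)//= addrCA lerDl addr_ge0//.
by apply: sumr_ge0 => j _; exact: sqr_ge0.
Qed.

Lemma lin_growth_sum (I : Type) (r : seq I) (F : I -> n.-tuple rT -> R) :
  (forall i, lin_growth (F i)) -> lin_growth (fun t => \sum_(i <- r) F i t).
Proof.
move=> qF; elim: r => [|i r IH].
  by under eq_fun do rewrite big_nil; exact: lin_growth_cst.
by under eq_fun do rewrite big_cons; exact: lin_growthD.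
Qed.

Lemma measurable_set_tnth (t : n.-tuple rT) j : measurable_fun setT (fun x : rT => set_tnth t j x).
Proof.
apply/measurable_fun_tnthP => i.
rewrite (_ : _ \o _ = if i == j then id else cst (tnth t i)).
  by case: ifP => _; [exact: measurable_id|exact: measurable_cst].
by apply/funext => x /=; rewrite tnth_mktuple; case: ifP.
Qed.

Lemma gaussE_stein (j : 'I_n) f (df : n.-tuple rT -> R) (K : R) :
  (forall t (x : R), is_derive x 1 (fun y : R => f (set_tnth t j y) : R) (df (set_tnth t j x))) ->
  measurable_fun setT df -> (forall t, `|df t| <= K) -> lin_growth f ->
  gaussE df = gaussE (fun t => tnth t j * f t).
Proof.
move=> dfx mdf dfK lf; rewrite /gaussE /Rintegral; congr fine.
apply: (gauss_tuple_coord (j := j)).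
- split => //; exists `|K| => t; rewrite (le_trans (dfK t))// (le_trans (ler_norm _))//.
  by rewrite ler_peMr// lerDl sqnorm_ge0.
- by apply: lin_growth_mul => //; exact: lin_growth_tnth.
move=> t; under [RHS]eq_integral do rewrite tnth_mktuple eqxx.
apply: (@stein1 R (fun y : R => f (set_tnth t j y)) (fun y : R => df (set_tnth t j y)) K) => //.
exact: (measurableT_comp mdf (measurable_set_tnth _ _)).
Qed.

(** Stein's identity for the constant function 1. *)
Lemma gaussE_tnth (j : 'I_n) : gaussE (fun t : n.-tuple rT => tnth t j : R) = 0.
Proof.
have := @gaussE_stein j (fun _ => 1) (fun _ => 0) 0.
rewrite gaussE_cst => ->.
- by congr gaussE; apply/funext => t; rewrite mulr1.
- exact: measurable_cst.
- by move=> t; rewrite normr0.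
- exact: lin_growth_cst.
Qed.

(** Stein's identity in coordinate [i] for the coordinate function [j], whose derivative is
    [(i == j)%:R]. *)
Lemma gaussE_tnth_mul (i j : 'I_n) :
  gaussE (fun t : n.-tuple rT => tnth t i * tnth t j : R) = (i == j)%:R.
Proof.
have dd (t : n.-tuple rT) (x : R) : is_derive x 1
    (fun y : R => tnth (set_tnth t i y) j : R) ((fun=> (i == j)%:R) (set_tnth t i x)).
  rewrite (_ : (fun y : R => _) = if i == j then id else cst (tnth t j)).
    by case: eqP => _; [exact: is_derive_id|exact: is_derive_cst].
  by apply/funext => y; rewrite tnth_mktuple eq_sym; case: eqP.
transitivity (gaussE (fun _ : n.-tuple rT => (i == j)%:R)); last exact: gaussE_cst.
apply/esym; apply: (@gaussE_stein i (fun t => tnth t j) (fun=> _) 1 dd).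
- exact: measurable_cst.
- by move=> t; case: eqP => _; rewrite ?normr1 ?normr0.
- exact: lin_growth_tnth.
Qed.

End gaussE.

Section vec.
Context {d : nat}.

Definition vec (t : d.-tuple rT) : 'cV[R]_d := \col_i tnth t i.

Lemma vec_nth (t : d.-tuple rT) : (\col_i nth 0 (val t) i : 'cV[R]_d) = vec t.
Proof. by apply/colP => i; rewrite !mxE (tnth_nth 0). Qed.

Lemma std_gauss_E_ge0 (g : 'cV[R]_d -> \bar R) :
  (forall e, 0 <= g e)%E -> (0 <= std_gauss_E g)%E.
Proof. by move=> g0; apply: gauss_int_ge0. Qed.

Lemma std_gauss_E_le (f g : 'cV[R]_d -> \bar R) :
  (forall e, 0 <= f e)%E -> (forall e, f e <= g e)%E ->
  (std_gauss_E f <= std_gauss_E g)%E.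
Proof. by move=> f0 fg; apply: gauss_int_le. Qed.

Lemma std_gauss_E_ge0E (g : 'cV[R]_d -> \bar R) :
  measurable_fun setT (fun t => g (vec t)) -> (forall e, 0 <= g e)%E ->
  (std_gauss_E g = \int[gauss_tuple d]_t g (vec t))%E.
Proof.
move=> mg g0; rewrite /std_gauss_E gauss_int_ge0E//.
  by apply: eq_integral => t _; rewrite vec_nth.
by under eq_fun do rewrite vec_nth.
Qed.

Lemma std_gauss_E_quad (g : 'cV[R]_d -> R) :
  quad_growth (fun t => g (vec t)) ->
  (std_gauss_E (fun e => (g e)%:E) = (gaussE (fun t => g (vec t)))%:E)%E.
Proof.
move=> qg; rewrite /std_gauss_E gauss_int_quad.
  by rewrite -gaussE_EFin//; apply: eq_integral => t _; rewrite vec_nth.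
by under eq_fun do rewrite vec_nth.
Qed.

Definition grid (n : nat) (x : R) : int := Num.floor (n.+1%:R * x).

Definition grid_vec (n : nat) (z : {ffun 'I_d -> int}) : 'cV[R]_d :=
  \col_i ((z i)%:~R / n.+1%:R).

(* A continuous function is the pointwise limit of its values at grid points, which are countably valued. *)
Lemma measurable_continuous_vec (G : 'cV[R]_d -> R) : continuous G ->
  measurable_fun setT (fun t : d.-tuple rT => G (vec t)).
Proof.
move=> cG.
pose z n (t : d.-tuple rT) : {ffun 'I_d -> int} := [ffun i => grid n (tnth t i)].
apply: (@measurable_fun_cvg _ _ _ _ (fun n t => G (grid_vec n (z n t)))).
  move=> n _ A mA; rewrite setTI.
  have -> : (fun t => G (grid_vec n (z n t))) @^-1` A =
    \bigcup_(w in [set: {ffun 'I_d -> int}])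
      (if `[< A (G (grid_vec n w)) >] then
      \bigcap_(i in [set: 'I_d]) [set t : d.-tuple rT | grid n (tnth t i) = w i] else set0).
    apply/seteqP; split => t /=.
      move=> At; exists (z n t) => //; case: asboolP => // _ i _ /=.
      by rewrite ffunE.
    move=> [w _]; case: asboolP => // Aw wt.
    have -> // : z n t = w by apply/ffunP => i; rewrite ffunE; exact: wt.
  apply: countable_bigcupT_measurable => [|w]; first exact: countableP.
  case: asboolP => // _.
  apply: fin_bigcap_measurable => // i _.
  have -> : [set t : d.-tuple rT | grid n (tnth t i) = w i] =
    (fun t : d.-tuple rT => tnth t i) @^-1`
      ((fun x : rT => n.+1%:R * x) @^-1` `[(w i)%:~R, (w i + 1)%:~R[%classic).
    apply/seteqP; split => t /=; rewrite in_itv/= /grid.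
      by move=> <-; exact: floor_itv.
    by move=> /floor_def.
  rewrite -[X in measurable X]setTI; apply: measurable_tnth => //.
  by rewrite -[X in measurable X]setTI; apply: measurable_funM.
move=> t _.
suff h : (fun n => grid_vec n (z n t)) @ \oo --> vec t.
  have := cvg_comp _ _ h (cG (vec t)); exact.
apply/cvgrPdist_le => e e0.
have : \forall n \near \oo, (n.+1%:R^-1 : R) <= e.
  have := @cvg_harmonic R; move/cvgrPdist_le => /(_ e e0).
  by apply: filterS => n /=; rewrite sub0r normrN ger0_norm.
apply: filterS => n ne; rewrite [leLHS]/Num.Def.normr/= mx_normrE.
apply: bigmax_le; [exact: ltW|move=> [i j] _ /=].
rewrite !mxE ffunE /grid (le_trans _ ne)//.
have n0 : (0 : R) < n.+1%:R by rewrite ltr0n.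
have := floor_itv (n.+1%:R * tnth t i : R); rewrite intrD => /andP[].
set q := (Num.floor _)%:~R => q1 q2.
have -> : tnth t i - q / n.+1%:R = (n.+1%:R * tnth t i - q) / n.+1%:R.
  by field; rewrite gt_eqF.
rewrite ger0_norm; last by rewrite divr_ge0// subr_ge0.
by rewrite ler_pdivrMr// mulVf ?gt_eqF// lerBlDl ltW.
Qed.

End vec.
End gauss_expectation.

(** * Smooth and strongly convex potentials *)

Section dot.
Context {R : realType} {d : nat}.
Implicit Types u v w : 'cV[R]_d.

Definition dot u v : R := \sum_i u i 0 * v i 0.

Lemma dotE u v : (u^T *m v) 0 0 = dot u v.
Proof. by rewrite mxE; apply: eq_bigr => i _; rewrite mxE. Qed.

Lemma dotC u v : dot u v = dot v u.
Proof. by apply: eq_bigr => i _; rewrite mulrC. Qed.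

Lemma dotDl u v w : dot (u + v) w = dot u w + dot v w.
Proof. by rewrite -big_split; apply: eq_bigr => i _; rewrite mxE mulrDl. Qed.

Lemma dotZl (c : R) u v : dot (c *: u) v = c * dot u v.
Proof. by rewrite mulr_sumr; apply: eq_bigr => i _; rewrite mxE mulrA. Qed.

Lemma dotNl u v : dot (- u) v = - dot u v.
Proof. by rewrite -scaleN1r dotZl mulN1r. Qed.

Lemma dotBl u v w : dot (u - v) w = dot u w - dot v w.
Proof. by rewrite dotDl dotNl. Qed.

Lemma dotDr u v w : dot w (u + v) = dot w u + dot w v.
Proof. by rewrite dotC dotDl !(dotC w). Qed.

Lemma dotZr (c : R) u v : dot u (c *: v) = c * dot u v.
Proof. by rewrite dotC dotZl dotC. Qed.

Lemma dotNr u v : dot u (- v) = - dot u v.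
Proof. by rewrite dotC dotNl dotC. Qed.

Lemma dotBr u v w : dot w (u - v) = dot w u - dot w v.
Proof. by rewrite dotDr dotNr. Qed.

Lemma dot_ge0 u : 0 <= dot u u.
Proof. by apply: sumr_ge0 => i _; rewrite -expr2 sqr_ge0. Qed.

Lemma dot_young (c : R) u v : 0 < c -> 2 * dot u v <= c * dot u u + c^-1 * dot v v.
Proof.
move=> c0; have := dot_ge0 (c *: u - v).
rewrite !(dotBl, dotBr, dotZl, dotZr) (dotC v u) => h.
have e : c * c^-1 = 1 by rewrite divff ?gt_eqF.
have ci : 0 < c^-1 by rewrite invr_gt0.
set a := dot u u in h *; set b := dot u v in h *; set w := dot v v in h *.
have h2 : 0 <= c^-1 * (c * (c * a) - c * b - (c * b - w)).
  by apply: mulr_ge0; [exact: ltW|rewrite -mulrBr].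
have -> : c * a + c^-1 * w = c^-1 * (c * (c * a) - c * b - (c * b - w)) + 2 * b.
  by field; rewrite gt_eqF.
by rewrite lerDr.
Qed.

Lemma dot_sqr_le u i : u i 0 ^+ 2 <= dot u u.
Proof.
rewrite /dot (bigD1 i)//= -expr2 lerDl sumr_ge0// => j _.
by rewrite -expr2 sqr_ge0.
Qed.

End dot.

Lemma cvg_sum_seq {R : realType} (I : Type) (r : seq I) (f : I -> nat -> R) (a : I -> R) :
  (forall i, f i @ \oo --> a i) ->
  (fun n => \sum_(i <- r) f i n) @ \oo --> \sum_(i <- r) a i.
Proof.
move=> fa; elim: r => [|i r IH].
  by rewrite big_nil; under eq_fun do rewrite big_nil; exact: cvg_cst.
by rewrite big_cons; under eq_fun do rewrite big_cons; exact: cvgD.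
Qed.

Section affine.
Context {R : realType} {d : nat}.
Local Notation rT := (measurableTypeR R).

Lemma to_tupleK (z : 'cV[R]_d) : vec (to_tuple z) = z.
Proof. by apply/colP => i; rewrite mxE tnth_mktuple. Qed.

Lemma affineE (C : 'M[R]_d) (m : 'cV[R]_d) t i :
  (C *m vec t + m) i 0 = \sum_j C i j * tnth t j + m i 0.
Proof. by rewrite mxE mxE; congr (_ + _); apply: eq_bigr => j _; rewrite mxE. Qed.

Lemma lin_growth_affine (C : 'M[R]_d) (m : 'cV[R]_d) i :
  lin_growth (fun t => (C *m vec t + m) i 0).
Proof.
under eq_fun do rewrite affineE.
apply: lin_growthD; last exact: lin_growth_cst.
by apply: lin_growth_sum => j; apply: lin_growthZ; exact: lin_growth_tnth.
Qed.

Lemma measurable_affine (C : 'M[R]_d) (m : 'cV[R]_d) :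
  measurable_fun setT (fun t => to_tuple (C *m vec t + m) : d.-tuple rT).
Proof.
apply/measurable_fun_tnthP => i.
have [h _] := lin_growth_affine C m i.
by apply: eq_measurable_fun h => t _ /=; rewrite tnth_mktuple.
Qed.

End affine.

Section line.
Context {R : realType} {d : nat}.

Lemma is_derive_line (W : normedModType R) (f : 'cV[R]_d -> W) (x v : 'cV[R]_d) (s : R) :
  differentiable f (x + s *: v) ->
  is_derive s (1 : R) (fun s : R => f (x + s *: v)) ('D_v f (x + s *: v)).
Proof.
move=> df; have dv : derivable f (x + s *: v) v by exact: diff_derivable.
have e : (fun h : R => h^-1 *: (((fun s : R => f (x + s *: v)) \o shift s) (h *: (1:R)) - f (x + s *: v))) =
  (fun h : R => h^-1 *: ((f \o shift (x + s *: v)) (h *: v) - f (x + s *: v))).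
  apply/funext => h /=; congr (_ *: (f _ - _)).
  have -> : h *: (1 : R) = h by rewrite /GRing.scale/= mulr1.
  by rewrite scalerDl addrCA.
by apply: DeriveDef; rewrite /derivable /derive e.
Qed.

Lemma derive_basis (W : normedModType R) (f : 'cV[R]_d -> W) (x v : 'cV[R]_d) :
  differentiable f x -> 'D_v f x = \sum_i v i 0 *: 'D_(basis_vec i) f x.
Proof.
move=> df; rewrite deriveE//.
have {1}-> : v = \sum_i v i 0 *: basis_vec i.
  apply/colP => k; rewrite summxE (bigD1 k)//= !mxE !eqxx mulr1 big1 ?addr0// => i ik.
  by rewrite !mxE eq_sym (negbTE ik) mulr0.
rewrite linear_sum; apply: eq_bigr => i _.
by rewrite linearZ/= deriveE.
Qed.

End line.

Section potential.
Context {R : realType} {d : nat}.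
Variables (U : 'cV[R]_d -> R) (mu L : R).
Hypothesis tdU : twice_differentiable U.
Hypothesis mu0 : 0 < mu.
Hypothesis L0 : 0 < L.
Hypothesis hessU : forall z v : 'cV[R]_d,
  mu * (v^T *m v) 0 0 <= (v^T *m hess U z *m v) 0 0 /\
  (v^T *m hess U z *m v) 0 0 <= L * (v^T *m v) 0 0.
Implicit Types x y z u v w : 'cV[R]_d.
Local Notation g := (grad U).

Lemma derive_grad x v : 'D_v U x = dot (g x) v.
Proof.
rewrite derive_basis; last by case: tdU.
by apply: eq_bigr => i _; rewrite mxE mulrC.
Qed.

(** With the column index of [hess] as the direction of differentiation, the Hessian acts on [v] as
    the differential of the gradient, and no symmetry enters. *)
Lemma derive_hess x v : 'D_v g x = hess U x *m v.
Proof.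
rewrite derive_basis; last by case: tdU.
apply/colP => i; rewrite summxE mxE; apply: eq_bigr => j _.
by rewrite !mxE mulrC.
Qed.

Lemma is_derive_U x v (s : R) :
  is_derive s (1 : R) (fun s : R => U (x + s *: v)) (dot (g (x + s *: v)) v).
Proof. by rewrite -derive_grad; apply: is_derive_line; case: tdU. Qed.

Lemma is_derive_grad x v (s : R) i :
  is_derive s (1 : R) (fun s : R => g (x + s *: v) i 0) ((hess U (x + s *: v) *m v) i 0).
Proof.
have dg : differentiable g (x + s *: v) by case: tdU.
have [dv dvE] := @is_derive_line R d _ g x v s dg.
have h := (derivable_mxP _ _ _).1 dv i 0.
have e := derive_mx dv.
rewrite dvE derive_hess in e.
apply: DeriveDef; first exact: h.
by rewrite e mxE.
Qed.

Lemma is_derive_dot_grad x v w (s : R) :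
  is_derive s (1 : R) (fun s : R => dot (g (x + s *: v)) w) (dot (hess U (x + s *: v) *m v) w).
Proof.
have h i : is_derive s (1 : R) (w i 0 \*: (fun s : R => g (x + s *: v) i 0))
    (w i 0 *: ((hess U (x + s *: v) *m v) i 0)).
  by apply: is_deriveZ; exact: is_derive_grad.
have := @is_derive_sum R R R d _ s 1 _ h.
congr (is_derive _ _ _ _); last by apply: eq_bigr => i _; rewrite mulrC.
by apply/funext => r; rewrite fct_sumE; apply: eq_bigr => i _; rewrite mulrC.
Qed.

Lemma hess_bounds z v : mu * dot v v <= dot (hess U z *m v) v <= L * dot v v.
Proof.
have [] := hessU z v; rewrite -!mulmxA !dotE (dotC v (hess U z *m v)) => h1 h2.
by rewrite h1 h2.
Qed.

Lemma is_derive_continuous (f df : R -> R) :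
  (forall s : R, is_derive s 1 f (df s)) -> continuous f.
Proof.
move=> h s; apply: differentiable_continuous; apply/derivable1_diffP.
by case: (h s).
Qed.

Lemma MVT01 (f df : R -> R) : (forall s : R, is_derive s 1 f (df s)) ->
  exists2 c, 0 < c < 1 & f 1 - f 0 = df c.
Proof.
move=> h; have [c + ->] := MVT ltr01 (fun s _ => h s)
  (continuous_subspaceT (is_derive_continuous h)).
by rewrite in_itv/= subr0 mulr1 => c01; exists c.
Qed.

Lemma grad_mono x y :
  mu * dot (y - x) (y - x) <= dot (g y - g x) (y - x) <= L * dot (y - x) (y - x).
Proof.
have [c _] := MVT01 (is_derive_dot_grad x (y - x) (y - x)).
rewrite scale1r scale0r addr0 subrKC -dotBl => ->.
exact: hess_bounds.
Qed.

Lemma grad_mono_line x v (c : R) : 0 < c ->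
  0 <= dot (g (x + c *: v) - g x) v <= L * (c * dot v v).
Proof.
move=> c0; have := grad_mono x (x + c *: v).
rewrite addrAC subrr add0r !dotZr !dotZl => /andP[h1 h2].
have := dot_ge0 v => v0.
set D := dot (_ - _) v in h1 h2 *.
have D0 : 0 <= c * D by apply: le_trans h1; rewrite !mulr_ge0// ltW.
apply/andP; split; first by rewrite -(pmulr_rge0 _ c0).
by rewrite -(ler_pM2l c0) (le_trans h2)// mulrCA.
Qed.

Lemma convexU x y : U x + dot (g x) (y - x) <= U y.
Proof.
have [c /andP[c0 _]] := MVT01 (is_derive_U x (y - x)).
rewrite scale1r scale0r addr0 subrKC => e.
have /andP[h _] := grad_mono_line x (y - x) c0.
by rewrite dotBl in h; lra.
Qed.

(** Second-order Taylor is avoided: the quadratic upper bound is subtracted along the segment, and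
    the mean value theorem is applied once to the difference, whose derivative is nonpositive by
    [grad_mono_line]. *)
Lemma smoothU x v : U (x + v) <= U x + dot (g x) v + L / 2 * dot v v.
Proof.
pose f := fun s : R => U (x + s *: v) - (dot (g x) v * s + L / 2 * dot v v * s ^+ 2).
have df (s : R) : is_derive s 1 f (dot (g (x + s *: v)) v - (dot (g x) v + L * dot v v * s)).
  apply: is_deriveB; first exact: is_derive_U.
  apply: is_derive_eq.
  by rewrite /GRing.scale/=; field.
have [c /andP[c0 _]] := MVT01 df.
rewrite /f scale1r scale0r addr0.
have /andP[_ h] := grad_mono_line x v c0.
by rewrite dotBl in h; lra.
Qed.

(** The convex lower bound at [x'] and the smooth upper bound at [y'] are compared at the gradient
    step [y' - L^-1 *: D]. Adding the two resulting inequalities, with the points exchanged, cancels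
    the values of [U]. *)
Lemma cocoercive x y : dot (g y - g x) (g y - g x) <= L * dot (g y - g x) (y - x).
Proof.
have main x' y' : dot (g y' - g x') (g y' - g x') <=
    2 * L * (U y' - U x' - dot (g x') (y' - x')).
  set D := g y' - g x'.
  have h1 := convexU x' (y' + - L^-1 *: D).
  have h2 := smoothU y' (- L^-1 *: D).
  rewrite -addrAC addrC dotDr dotZr in h1.
  rewrite dotZl !dotZr in h2.
  have h3 : dot D D = dot (g y') D - dot (g x') D by rewrite /D dotBl.
  have Li : L * L^-1 = 1 by rewrite divff ?gt_eqF.
  set i := L^-1 in h1 h2 Li; set a := dot (g y') D in h2 h3; set b := dot (g x') D in h1 h3.
  have h4 : i * (a - b) - L / 2 * (i * (i * dot D D)) <= U y' - U x' - dot (g x') (y' - x').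
    have -> : L / 2 * (i * (i * dot D D)) = L / 2 * (- i * (- i * dot D D)) by ring.
    lra.
  rewrite -h3 in h4.
  have -> : dot D D = 2 * L * (i * dot D D - L / 2 * (i * (i * dot D D))).
    have -> : 2 * L * (i * dot D D - L / 2 * (i * (i * dot D D))) =
      (2 * (L * i) - (L * i) * (L * i)) * dot D D by field.
    by rewrite Li; ring.
  by rewrite ler_wpM2l// mulr_ge0// ltW.
have := main x y; have := main y x.
have -> : dot (g x - g y) (g x - g y) = dot (g y - g x) (g y - g x).
  by rewrite -opprB dotNl dotNr opprK.
have -> : dot (g y) (x - y) = - dot (g y) (y - x) by rewrite -opprB dotNr.
rewrite !dotBl; lra.
Qed.

Lemma grad_lipschitz x y : dot (g y - g x) (g y - g x) <= L ^+ 2 * dot (y - x) (y - x).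
Proof.
have /andP[_ h] := grad_mono x y.
by rewrite (le_trans (cocoercive x y))// expr2 -mulrA ler_wpM2l// ltW.
Qed.

Lemma grad_quotient_cvg z v i :
  (fun n : nat => n.+1%:R * (g (z + n.+1%:R^-1 *: v) i 0 - g z i 0)) @ \oo --> (hess U z *m v) i 0.
Proof.
have := @quotient_cvg R (fun s : R => g (z + s *: v) i 0) _ 0 (is_derive_grad z v 0 i).
by rewrite scale0r addr0; under eq_fun do rewrite add0r.
Qed.

(* Dividing co-coercivity at [z] and [z + v / n] by [1 / n ^ 2] avoids any use of the symmetry of the Hessian. *)
Lemma hess_sqr_le z v : dot (hess U z *m v) (hess U z *m v) <= L * dot (hess U z *m v) v.
Proof.
pose q (n : nat) : 'cV[R]_d := n.+1%:R *: (g (z + n.+1%:R^-1 *: v) - g z).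
have qc i : (fun n => q n i 0) @ \oo --> (hess U z *m v) i 0.
  have -> : (fun n => q n i 0) =
      (fun n : nat => n.+1%:R * (g (z + n.+1%:R^-1 *: v) i 0 - g z i 0)).
    by apply/funext => n; rewrite mxE [in LHS]mxE [X in _ + X]mxE.
  exact: grad_quotient_cvg.
have c1 : (fun n => dot (q n) (q n)) @ \oo --> dot (hess U z *m v) (hess U z *m v).
  by apply: cvg_sum_seq => i; apply: cvgM.
have c2 : (fun n => L * dot (q n) v) @ \oo --> L * dot (hess U z *m v) v.
  by apply: cvgM; [exact: cvg_cst|apply: cvg_sum_seq => i; apply: cvgM => //; exact: cvg_cst].
apply: (ler_cvg_to c1 c2); apply: nearW => n.
rewrite /q !dotZl !dotZr.
have := cocoercive z (z + n.+1%:R^-1 *: v); rewrite addrAC subrr add0r dotZr.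
have n0 : (0 : R) < n.+1%:R by [].
set D := g _ - _; set N := n.+1%:R in n0 *; move=> h.
have -> : L * (N * dot D v) = N * (N * (L * (N^-1 * dot D v))).
  by field; rewrite gt_eqF.
by rewrite !ler_pM2l.
Qed.

Lemma continuous_grad i : continuous (fun z => g z i 0).
Proof.
move=> z; have [_ dg] := tdU.
exact: (cvg_comp _ _ (differentiable_continuous (dg z)) (@coord_continuous _ _ _ i 0 _)).
Qed.

Lemma continuous_U : continuous U.
Proof. by move=> z; apply: differentiable_continuous; case: tdU. Qed.

Lemma measurable_comp_affine (G : 'cV[R]_d -> R) (C : 'M[R]_d) m : continuous G ->
  measurable_fun setT (fun t => G (C *m vec t + m)).
Proof.
move=> cG; have := measurableT_comp (measurable_continuous_vec cG) (measurable_affine C m).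
by apply: eq_measurable_fun => t _ /=; rewrite to_tupleK.
Qed.

(** A pointwise limit of difference quotients of the gradient, which are continuous. *)
Lemma measurable_hess (C : 'M[R]_d) m v i :
  measurable_fun setT (fun t => (hess U (C *m vec t + m) *m v) i 0).
Proof.
apply: (@measurable_fun_cvg _ _ _ _ (fun n t => n.+1%:R *
   (g (C *m vec t + m + n.+1%:R^-1 *: v) i 0 - g (C *m vec t + m) i 0))).
  move=> n; apply: measurable_funM => //; apply: measurable_funB.
    have := measurable_comp_affine C (m + n.+1%:R^-1 *: v) (@continuous_grad i).
    by apply: eq_measurable_fun => t _ /=; rewrite addrA.
  exact: (measurable_comp_affine C m (@continuous_grad i)).
by move=> t _; exact: grad_quotient_cvg.
Qed.

End potential.

(** * Gaussian moments of vector-valued integrands *)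

Section lin_vec.
Context {R : realType} {d : nat}.
Local Notation rT := (measurableTypeR R).
Implicit Types u v : d.-tuple rT -> 'cV[R]_d.

Lemma vecK (t : d.-tuple rT) : to_tuple (vec t) = t.
Proof. by apply: eq_from_tnth => i; rewrite tnth_mktuple mxE. Qed.

Lemma lin_growth_quad (f : d.-tuple rT -> R) : lin_growth f -> quad_growth f.
Proof.
move=> lf; have := lin_growth_mul lf (lin_growth_cst (1 : R)).
by have -> : (fun t => f t * 1) = f by apply/funext => t; rewrite mulr1.
Qed.

Definition lin_vec u := forall i, lin_growth (fun t => u t i 0).

Lemma lin_vecB u v : lin_vec u -> lin_vec v -> lin_vec (fun t => u t - v t).
Proof.
move=> lu lv i; under eq_fun do rewrite mxE [X in _ + X]mxE.
by apply: lin_growthD => //; exact: lin_growthN.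
Qed.

Lemma lin_vec_cst (c : 'cV[R]_d) : lin_vec (fun=> c).
Proof. by move=> i; exact: lin_growth_cst. Qed.

Lemma lin_vec_affine (C : 'M[R]_d) m : lin_vec (fun t => C *m vec t + m).
Proof. by move=> i; exact: lin_growth_affine. Qed.

Lemma lin_vec_mul (C : 'M[R]_d) : lin_vec (fun t => C *m vec t).
Proof.
by move=> i; have := lin_growth_affine C 0 i; under eq_fun do rewrite addr0.
Qed.

Lemma quad_growth_dot u v : lin_vec u -> lin_vec v -> quad_growth (fun t => dot (u t) (v t)).
Proof. by move=> lu lv; apply: quad_growth_sum => i; exact: lin_growth_mul. Qed.

Lemma gaussE_tnth_sum (c : 'I_d -> R) : gaussE (fun t : d.-tuple rT => \sum_j c j * tnth t j) = 0.
Proof.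
have q j : quad_growth (fun t : d.-tuple rT => tnth t j : R).
  exact: lin_growth_quad (lin_growth_tnth j).
rewrite gaussE_sum; last by move=> j; exact: quad_growthZ.
by rewrite big1// => j _; rewrite gaussE_Z// gaussE_tnth mulr0.
Qed.

Lemma gaussE_dot_mul (w : 'cV[R]_d) (C : 'M[R]_d) : gaussE (fun t => dot w (C *m vec t)) = 0.
Proof.
rewrite -(gaussE_tnth_sum (fun j => \sum_i w i 0 * C i j)); congr gaussE; apply/funext => t.
under [RHS]eq_bigr do rewrite mulr_suml; rewrite exchange_big; apply: eq_bigr => i _.
by rewrite mxE mulr_sumr; apply: eq_bigr => j _; rewrite mxE mulrA.
Qed.

(** This makes the Euclidean norm of a parameter difference the mean square distance between the two
    reparametrized variables. It gives the cost of the synchronous coupling and transfers strong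
    monotonicity from points to parameters. *)
Lemma gaussE_dot_affine_sqr (C : 'M[R]_d) m :
  gaussE (fun t => dot (C *m vec t + m) (C *m vec t + m)) =
  \sum_i m i 0 ^+ 2 + \sum_i \sum_j C i j ^+ 2.
Proof.
have lC := lin_vec_mul C; have lm := lin_vec_cst m.
have e t : dot (C *m vec t + m) (C *m vec t + m) =
    dot (C *m vec t) (C *m vec t) + (2 * dot m (C *m vec t) + dot m m).
  by rewrite !(dotDl, dotDr) (dotC (C *m vec t) m); ring.
under [in LHS]eq_fun do rewrite e.
have q1 := quad_growth_dot lC lC; have q2 := quad_growth_dot lm lC.
have q3 := quad_growth_cst (dot m m); have q4 := quad_growthZ 2 q2.
rewrite gaussE_D//; last exact: quad_growthD.
rewrite gaussE_D// gaussE_Z// gaussE_dot_mul mulr0 add0r gaussE_cst addrC; congr (_ + _).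
have qt j k : quad_growth (fun t : d.-tuple rT => tnth t j * tnth t k : R).
  by apply: lin_growth_mul; exact: lin_growth_tnth.
have e2 t : dot (C *m vec t) (C *m vec t) =
    \sum_i \sum_j \sum_k (C i j * C i k) * (tnth t j * tnth t k).
  apply: eq_bigr => i _; rewrite mxE mulr_suml; apply: eq_bigr => j _.
  rewrite mulr_sumr; apply: eq_bigr => k _; rewrite !mxE; ring.
under [in LHS]eq_fun do rewrite e2.
have qk i j : quad_growth (fun t : d.-tuple rT => \sum_k (C i j * C i k) * (tnth t j * tnth t k)).
  by apply: quad_growth_sum => k; exact: quad_growthZ.
rewrite gaussE_sum => [|i]; last by apply: quad_growth_sum.
apply: eq_bigr => i _; rewrite gaussE_sum//; apply: eq_bigr => j _.
rewrite gaussE_sum => [|k]; last exact: quad_growthZ.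
rewrite (bigD1 j)//= gaussE_Z// gaussE_tnth_mul eqxx mulr1 big1 ?addr0 ?expr2// => k kj.
by rewrite gaussE_Z// gaussE_tnth_mul eq_sym (negbTE kj) mulr0.
Qed.

End lin_vec.

(** * Synchronous coupling *)

Section W2.
Context {R : realType} {d : nat}.
Local Notation rT := (measurableTypeR R).
Implicit Types l : @param R d.

Lemma W2sq_ge0 (p q : set (d.-tuple R) -> \bar R) : (0 <= W2sq p q)%E.
Proof.
apply: le_ereal_inf_tmp => _ [P [_ ->]].
by apply: integral_ge0 => z _; rewrite lee_fin sumr_ge0// => i _; rewrite sqr_ge0.
Qed.

Definition reparam l (t : d.-tuple rT) : 'cV[R]_d := l.2 *m vec t + l.1.

Definition sync_map l l' (t : d.-tuple rT) : (d.-tuple R * d.-tuple R)%type :=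
  (to_tuple (reparam l t), to_tuple (reparam l' t)).

Lemma measurable_to_tuple_reparam l : measurable_fun setT (fun t => to_tuple (reparam l t) : d.-tuple R).
Proof.
apply/measurable_fun_tnthP => i.
have [h _] := lin_growth_affine l.2 l.1 i.
by apply: eq_measurable_fun h => t _ /=; rewrite tnth_mktuple.
Qed.

Lemma measurable_sync_map l l' : measurable_fun setT (sync_map l l').
Proof.
by apply/measurable_fun_pairP; split; exact: measurable_to_tuple_reparam.
Qed.

HB.instance Definition _ l l' := isMeasurableFun.Build _ _ _ _ (sync_map l l') (measurable_sync_map l l').

Lemma q_lawE l (A : set (d.-tuple R)) : measurable A ->
  q_law l A = gauss_tuple d ((fun t => to_tuple (reparam l t) : d.-tuple R) @^-1` A).
Proof.
move=> mA.
have mp : measurable ((fun t => to_tuple (reparam l t) : d.-tuple R) @^-1` A).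
  by rewrite -[X in measurable X]setTI; exact: measurable_to_tuple_reparam.
rewrite /q_law std_gauss_E_ge0E.
- set B := _ @^-1` _; transitivity (\int[gauss_tuple d]_t (\1_B t)%:E)%E; first by apply: eq_integral.
  by rewrite integral_indic// setIT.
- apply/measurable_EFinP.
  exact: (@measurable_indic _ _ R setT _ mp).
- by move=> e; rewrite lee_fin.
Qed.

Lemma W2sq_le l l' : (W2sq (q_law l) (q_law l') <= (param_sqnorm (param_sub l l'))%:E)%E.
Proof.
apply: ereal_inf_lbound; exists (distribution (gauss_tuple d) (sync_map l l')); split.
  move=> A mA; rewrite !q_lawE//; split; rewrite /distribution /pushforward; congr (gauss_tuple d _).
  - by apply/seteqP; split => t /=; [case|].
  - by apply/seteqP; split => t /=; [case|].
have e t : \sum_(i < d) (tnth (sync_map l l' t).1 i - tnth (sync_map l l' t).2 i) ^+ 2 =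
    dot ((l.2 - l'.2) *m vec t + (l.1 - l'.1)) ((l.2 - l'.2) *m vec t + (l.1 - l'.1)).
  apply: eq_bigr => i _; rewrite !tnth_mktuple /reparam -expr2 mulmxBl; congr (_ ^+ 2).
  by rewrite !mxE; ring.
rewrite ge0_integral_distribution; last 2 first.
- apply/measurable_EFinP; apply: measurable_sum => i; apply: measurable_funX.
  apply: measurable_funB.
    exact: (measurableT_comp (measurable_tnth i) measurable_fst).
  exact: (measurableT_comp (measurable_tnth i) measurable_snd).
- by move=> z; rewrite lee_fin sumr_ge0// => i _; rewrite sqr_ge0.
under eq_integral do rewrite /= e.
have q := quad_growth_dot (lin_vec_affine (l.2 - l'.2) (l.1 - l'.1)) (lin_vec_affine (l.2 - l'.2) (l.1 - l'.1)).
by rewrite gaussE_EFin// gaussE_dot_affine_sqr.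
Qed.

End W2.

(** * First-order conditions at the minimizer *)

Section first_order.
Context {R : realType}.

(** A first-order condition that asks for no differentiability: if [a] were nonzero, a small [s] of
    the opposite sign would make the expression negative. *)
Lemma quadratic_ge0_eq0 (a b s0 : R) : 0 < s0 ->
  (forall s, `|s| <= s0 -> 0 <= s * a + s ^+ 2 * b) -> a = 0.
Proof.
move=> s00 h; apply/eqP; apply: contraT => a0.
have na : 0 < `|a| by rewrite normr_gt0.
(* The test point is [s = - (a * r)]. The first bound keeps it within [s0]; the second gives
   [r * b <= 1 / 2], so the quadratic term cannot offset the linear one. *)
pose r := Num.min (s0 / `|a|) (2 * (`|b| + 1))^-1.
have r0 : 0 < r.
  by rewrite lt_min divr_gt0//= invr_gt0 mulr_gt0// ltr_wpDl.
have r1 : r * `|a| <= s0 by rewrite -ler_pdivlMr// ge_min lexx.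
have r2 : r * (2 * (`|b| + 1)) <= 1.
  rewrite -ler_pdivlMr ?mulr_gt0 ?ltr_wpDl// div1r ge_min lexx orbT//.
have {}r1 : `|- (a * r)| <= s0 by rewrite normrN normrM (ger0_norm (ltW r0)) mulrC.
have := h _ r1.
have bb := ler_norm b; have bb0 := normr_ge0 b.
have rb : r * b <= 1 / 2.
  have : r * b <= r * `|b| by rewrite ler_wpM2l// ltW.
  nra.
have a2 : 0 < a ^+ 2 by rewrite exprn_even_gt0.
have -> : - (a * r) * a + (- (a * r)) ^+ 2 * b = (a ^+ 2 * r) * (r * b - 1) by ring.
by rewrite (pmulr_rge0 _ (mulr_gt0 a2 r0)) => h2; exfalso; lra.
Qed.

(** With [x = w / c], one has [ln (1 + x) >= 1 - 1 / (1 + x) = x - x^2 / (1 + x)], and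
    [1 / (1 + x) <= 2] on the given range. *)
Lemma ln_add_ge (c w : R) : 0 < c -> `|w / c| <= 1 / 2 ->
  ln c + w / c - 2 * (w / c) ^+ 2 <= ln (c + w).
Proof.
move=> c0; set x := w / c => hx.
have -> : c + w = c * (1 + x) by rewrite /x; field; rewrite gt_eqF.
have /andP[x1 x2] : - (1 / 2) <= x <= 1 / 2 by rewrite -ler_norml.
have y0 : 0 < 1 + x by lra.
rewrite lnM ?posrE// -addrA lerD2l.
have := @le_ln1Dx R ((1 + x)^-1 - 1).
rewrite subrKC lnV ?posrE// => h.
have i0 : 0 < (1 + x)^-1 by rewrite invr_gt0.
have {}h : - ln (1 + x) <= (1 + x)^-1 - 1 by apply: h; lra.
have e : (1 + x)^-1 - 1 = - x + x ^+ 2 * (1 + x)^-1 by field; rewrite gt_eqF.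
have i2 : (1 + x)^-1 <= 2.
  by rewrite -[leRHS]invrK lef_pV2 ?posrE ?invr_gt0//; lra.
have := sqr_ge0 x; rewrite e in h; nra.
Qed.

Lemma ln_prod (I : Type) (r : seq I) (f : I -> R) : (forall i, 0 < f i) ->
  ln (\prod_(i <- r) f i) = \sum_(i <- r) ln (f i).
Proof.
move=> f0; elim: r => [|i r IH]; first by rewrite !big_nil ln1.
by rewrite !big_cons lnM ?posrE ?IH// prodr_gt0.
Qed.

End first_order.

(** * Price's identity, the free energy in coordinates, and stationarity *)

Section gaussian_gradient.
Context {R : realType} {d : nat}.
Local Notation rT := (measurableTypeR R).
Variables (U : 'cV[R]_d -> R) (mu L : R).
Hypothesis tdU : twice_differentiable U.
Hypothesis mu0 : 0 < mu.
Hypothesis L0 : 0 < L.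
Hypothesis hessU : forall z v : 'cV[R]_d,
  mu * (v^T *m v) 0 0 <= (v^T *m hess U z *m v) 0 0 /\
  (v^T *m hess U z *m v) 0 0 <= L * (v^T *m v) 0 0.
Local Notation g := (grad U).
Implicit Types l : @param R d.

Lemma quad_growth_le (f h : d.-tuple rT -> R) : measurable_fun setT f -> quad_growth h ->
  (forall t, `|f t| <= h t) -> quad_growth f.
Proof.
move=> mf [_ [K hK]] fh; split => //; exists K => t.
by rewrite (le_trans (fh t))// (le_trans _ (hK t))// ler_norm.
Qed.

Lemma lin_growth_le (f h : d.-tuple rT -> R) : measurable_fun setT f -> quad_growth h ->
  (forall t, f t ^+ 2 <= h t) -> lin_growth f.
Proof.
move=> mf [_ [K hK]] fh; split => //; exists K => t.
by rewrite (le_trans (fh t))// (le_trans _ (hK t))// ler_norm.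
Qed.

Lemma lin_vec_reparam l : lin_vec (reparam l).
Proof. exact: lin_vec_affine. Qed.

Lemma lin_vec_grad l : lin_vec (fun t => g (reparam l t)).
Proof.
move=> i; have qZ := quad_growth_dot (lin_vec_reparam l) (lin_vec_reparam l).
apply: (@lin_growth_le _ (fun t => 2 * L ^+ 2 * dot (reparam l t) (reparam l t) + 2 * (g 0 i 0) ^+ 2)).
- exact: (measurable_comp_affine l.2 l.1 (@continuous_grad _ _ _ tdU i)).
- by apply: quad_growthD; [exact: quad_growthZ|exact: quad_growth_cst].
move=> t; have := grad_lipschitz tdU mu0 L0 hessU 0 (reparam l t); rewrite subr0.
have := dot_sqr_le (g (reparam l t) - g 0) i; rewrite mxE [X in _ + X]mxE.
set D := dot _ (_ - _); set Z := dot (reparam l t) _; set a := g (reparam l t) i 0; set b := g 0 i 0.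
have := sqr_ge0 (a - 2 * b); rewrite -mulrA; set LZ := L ^+ 2 * Z.
by nra.
Qed.

(** Convexity and smoothness at the origin sandwich [U] between two functions of quadratic
    growth. *)
Lemma quad_growth_U l : quad_growth (fun t => U (reparam l t)).
Proof.
have qZ := quad_growth_dot (lin_vec_reparam l) (lin_vec_reparam l).
apply: (@quad_growth_le _ (fun t => (`|U 0| + dot (g 0) (g 0)) + (1 + L) * dot (reparam l t) (reparam l t))).
- exact: (measurable_comp_affine l.2 l.1 (continuous_U tdU)).
- by apply: quad_growthD; [exact: quad_growth_cst|exact: quad_growthZ].
move=> t; set z := reparam l t.
have h1 := convexU tdU mu0 hessU 0 z; have h2 := smoothU tdU mu0 hessU 0 z.
rewrite add0r in h2; rewrite subr0 in h1.
have h3 := dot_young (g 0) z (ltr01 : 0 < 1 :> R).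
have h4 := dot_young (- g 0) z (ltr01 : 0 < 1 :> R).
rewrite !dotNl dotNr in h4; rewrite invr1 in h3 h4.
have := ler_norm (U 0); have := ler_norm (- U 0); rewrite normrN.
have := dot_ge0 z; have := dot_ge0 (g 0).
set a := dot z z in h2 h3 h4 *; set b := dot (g 0) (g 0) in h3 h4 *; set u := `|U 0|.
set e := dot (g 0) z in h1 h2 h3 h4 => b0 a0 u1 u2.
have La : 0 <= L * a by rewrite mulr_ge0// ltW.
have e1 : L / 2 * a = L * a / 2 by field.
rewrite e1 in h2; have e2 : (1 + L) * a = a + L * a by ring.
by rewrite e2 ler_norml; apply/andP; split; lra.
Qed.

(** The [j]-th column of [H C], which is also the derivative of the gradient at the reparametrized
    point with respect to the noise coordinate [j]. *)
Definition hessC l (t : d.-tuple rT) (j : 'I_d) : 'cV[R]_d := hess U (reparam l t) *m col j l.2.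

Lemma hessC_sqr_le l t j i : hessC l t j i 0 ^+ 2 <= L ^+ 2 * dot (col j l.2) (col j l.2).
Proof.
apply: le_trans (dot_sqr_le _ _) _; apply: le_trans (hess_sqr_le tdU mu0 L0 hessU _ _) _.
have /andP[_ h] := hess_bounds hessU (reparam l t) (col j l.2).
by rewrite expr2 -mulrA ler_wpM2l// ltW.
Qed.

Lemma lin_vec_hessC l j : lin_vec (fun t => hessC l t j).
Proof.
move=> i; apply: lin_growth_bounded; first exact: (measurable_hess tdU).
by move=> t; exact: hessC_sqr_le.
Qed.

Lemma reparam_set_tnth l t j (y : R) :
  reparam l (set_tnth t j y) = reparam l (set_tnth t j 0) + y *: col j l.2.
Proof.
rewrite /reparam addrAC; congr (_ + _).
have -> : vec (set_tnth t j y) = vec (set_tnth t j 0) + y *: delta_mx j 0.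
  apply/colP => i; rewrite !mxE !tnth_mktuple eqxx andbT.
  by case: (i == j); rewrite ?mulr1 ?mulr0 ?add0r ?addr0.
by rewrite mulmxDr -scalemxAr colE.
Qed.

(** Varying one noise coordinate moves the reparametrized point along a line with direction
    [col j l.2], so Stein's identity applies to each gradient component. *)
Lemma gaussE_hessC l i j : gaussE (fun t => hessC l t j i 0) = gaussE (fun t => tnth t j * g (reparam l t) i 0).
Proof.
have dd t (x : R) : is_derive x (1 : R)
    (fun y : R => (fun t => g (reparam l t) i 0) (set_tnth t j y) : R)
    ((fun t => hessC l t j i 0) (set_tnth t j x)).
  rewrite /hessC reparam_set_tnth.
  rewrite (_ : (fun y : R => _) =
    (fun y : R => g (reparam l (set_tnth t j 0) + y *: col j l.2) i 0)).
    exact: is_derive_grad.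
  by apply/funext => y; rewrite reparam_set_tnth.
(* The available bound is on the square; [|a| <= a ^+ 2 + 1] turns it into a bound on the absolute
   value. *)
apply: (gaussE_stein (K := L ^+ 2 * dot (col j l.2) (col j l.2) + 1) dd).
- by have [] := lin_vec_hessC l j i.
- move=> t; have := hessC_sqr_le l t j i; set a := hessC l t j i 0.
  by rewrite -[a ^+ 2]real_normK ?num_real//; have := sqr_ge0 (`|a| - 1); nra.
- exact: lin_vec_grad.
Qed.

(** The right-hand integrand is the trace pairing of [H C] with [W]. Both sides are linear in [W],
    so the identity reduces to [gaussE_hessC] entry by entry. *)
Lemma gaussE_dot_grad_mul l (W : 'M[R]_d) :
  gaussE (fun t => dot (g (reparam l t)) (W *m vec t)) =
  gaussE (fun t => \sum_j dot (hessC l t j) (col j W)).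
Proof.
have q i j : quad_growth (fun t => tnth t j * g (reparam l t) i 0).
  by apply: lin_growth_mul; [exact: lin_growth_tnth|exact: lin_vec_grad].
have q' i j : quad_growth (fun t => hessC l t j i 0).
  by apply: lin_growth_quad; exact: lin_vec_hessC.
transitivity (\sum_j \sum_i W i j * gaussE (fun t => tnth t j * g (reparam l t) i 0)).
  under [RHS]eq_bigr => j _ do under eq_bigr => i _ do rewrite -gaussE_Z//.
  under [RHS]eq_bigr => j _ do rewrite -(gaussE_sum _ (fun i => quad_growthZ _ (q i j))).
  rewrite -gaussE_sum => [|j]; last by apply: quad_growth_sum => i; exact: quad_growthZ.
  congr gaussE; apply/funext => t; rewrite exchange_big; apply: eq_bigr => i _.
  by rewrite [(W *m _) i 0]mxE mulr_sumr; apply: eq_bigr => j _; rewrite [vec t j 0]mxE; ring.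
under eq_bigr => j _ do under eq_bigr => i _ do rewrite -gaussE_hessC -gaussE_Z//.
under eq_bigr => j _ do rewrite -(gaussE_sum _ (fun i => quad_growthZ _ (q' i j))).
rewrite -gaussE_sum => [|j]; last by apply: quad_growth_sum => i; exact: quad_growthZ.
congr gaussE; apply/funext => t; apply: eq_bigr => j _; apply: eq_bigr => i _.
by rewrite mulrC [col j W i 0]mxE.
Qed.

Lemma energyE l : energy U l = (gaussE (fun t => U (reparam l t)))%:E.
Proof. exact: (std_gauss_E_quad (quad_growth_U l)). Qed.

Lemma det_lower l : Lambda l -> \det l.2 = \prod_i l.2 i i.
Proof. by move=> [lt _]; apply: det_trig; apply/is_trig_mxP. Qed.

(** Along the reparametrization the quadratic form in the density collapses to [|eps|^2], whose mean
    is [d]. Hence only the diagonal of [l.2] matters, through the logarithm of its determinant. *)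
Lemma entropyE l : Lambda l ->
  entropy l = (ln ((Num.sqrt (pi *+ 2) ^+ d)^-1) - \sum_i ln (l.2 i i) - d%:R / 2)%:E.
Proof.
move=> Ll; have [_ dpos] := Ll.
have det0 : 0 < \det l.2 by rewrite det_lower//; apply: prodr_gt0 => i _; exact: dpos.
have uC : l.2 \in unitmx by rewrite unitmxE unitfE gt_eqF.
set K := ln _; set s := \sum_i _.
have e t : ln (gauss_pdf l (reparam l t)) = (K - s) - dot (vec t) (vec t) / 2.
  rewrite /gauss_pdf /reparam addrK det_mulmx det_tr -expr2 sqrtr_sqr (gtr0_norm det0).
  have -> : ((l.2 *m vec t)^T *m invmx (l.2 *m l.2^T) *m (l.2 *m vec t)) 0 0 =
      dot (vec t) (vec t).
    have uS : l.2 *m l.2^T \in unitmx by rewrite unitmx_mul uC unitmx_tr.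
    have : l.2^T *m invmx (l.2 *m l.2^T) *m l.2 = 1%:M.
      by apply: mulmx1C; rewrite mulmxA mulmxV.
    rewrite trmx_mul !mulmxA -!(mulmxA (vec t)^T) => h.
    by rewrite !mulmxA in h *; rewrite -!mulmxA (mulmxA l.2^T) (mulmxA (l.2^T *m _)) h mul1mx dotE.
  have p0 : 0 < (Num.sqrt (pi *+ 2) ^+ d)^-1 :> R.
    by rewrite invr_gt0 exprn_gt0// sqrtr_gt0 mulrn_wgt0// pi_gt0.
  have q0 : 0 < (\det l.2)^-1 by rewrite invr_gt0.
  rewrite lnM ?posrE ?expR_gt0//; last by rewrite mulr_gt0.
  rewrite lnM ?posrE// expRK [ln (\det _)^-1]lnV ?posrE// det_lower// -/K mulNr ln_prod//.
have e2 t : (K - s) - dot (vec t) (vec t) / 2 =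
    (K - s) - 2^-1 * \sum_(i < d) tnth t i * tnth t i.
  by rewrite mulrC; congr (_ - _ * _); apply: eq_bigr => i _; rewrite mxE.
have qi (i : 'I_d) : quad_growth (fun t : d.-tuple rT => tnth t i * tnth t i : R).
  by apply: lin_growth_mul; exact: lin_growth_tnth.
have qs : quad_growth (fun t : d.-tuple rT => \sum_(i < d) tnth t i * tnth t i : R).
  exact: quad_growth_sum.
have eF : (fun t => ln (gauss_pdf l (l.2 *m vec t + l.1))) =
    (fun t => (K - s) - 2^-1 * \sum_(i < d) tnth t i * tnth t i).
  by apply/funext => t; rewrite -e2 -e.
rewrite /entropy (@std_gauss_E_quad _ _ (fun e => ln (gauss_pdf l (l.2 *m e + l.1)))) eF.
  rewrite gaussE_B; [|exact: quad_growth_cst|exact: quad_growthZ].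
  rewrite gaussE_cst gaussE_Z// gaussE_sum//; congr (_ - _)%:E.
  under eq_bigr do rewrite gaussE_tnth_mul eqxx.
  by rewrite sumr_const card_ord mulrC.
by apply: quad_growthB; [exact: quad_growth_cst|exact: quad_growthZ].
Qed.

Section optimum.
Variable ls : @param R d.
Hypothesis Lls : Lambda ls.
Hypothesis opt : forall l, Lambda l -> (free_energy U ls <= free_energy U l)%E.

Lemma opt_real l : Lambda l ->
  gaussE (fun t => U (reparam ls t)) - \sum_i ln (ls.2 i i) <=
  gaussE (fun t => U (reparam l t)) - \sum_i ln (l.2 i i).
Proof.
move=> Ll; have := opt Ll; rewrite /free_energy !energyE !entropyE// -!EFinD lee_fin; lra.
Qed.

(** Differentiation under the integral is avoided. Along the line [ls + s (v, W)], [smoothU] bounds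
    the energy above and [ln_add_ge] bounds the logarithms below, both with errors of order
    [s ^+ 2]. Optimality then yields a nonnegative quadratic in [s] without constant term, for both
    signs of [s], so its slope vanishes. *)
Lemma stationarity (v : 'cV[R]_d) (W : 'M[R]_d) : lower_tri W ->
  gaussE (fun t => dot (g (reparam ls t)) (W *m vec t + v)) = \sum_i W i i / ls.2 i i.
Proof.
move=> lW; have [lC dpos] := Lls.
pose x i := W i i / ls.2 i i.
pose A := gaussE (fun t => dot (g (reparam ls t)) (W *m vec t + v)).
pose B := L / 2 * gaussE (fun t => dot (W *m vec t + v) (W *m vec t + v)).
have lg := lin_vec_grad ls; have lw := lin_vec_affine W v.
(* For [|s| <= s0] every ratio [s * W i i / ls.2 i i] is at most 1/2 in absolute value, which keeps
   the perturbed parameter in [Lambda] and meets the condition of [ln_add_ge]. The summand 1 keeps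
   the denominator positive. *)
pose s0 := (2 * (1 + \sum_i `|x i|))^-1.
have sx0 : 0 <= \sum_i `|x i| by apply: sumr_ge0.
have s00 : 0 < s0 by rewrite invr_gt0 mulr_gt0// ltr_pwDl.
suff : A - \sum_i x i = 0 by move=> /eqP; rewrite subr_eq0 => /eqP.
apply: (@quadratic_ge0_eq0 _ _ (B + \sum_i 2 * x i ^+ 2) s0 s00) => s ss0.
have sx i : `|s * W i i / ls.2 i i| <= 1 / 2.
  rewrite -mulrA normrM; apply: (@le_trans _ _ (s0 * (1 + \sum_i `|x i|))).
    rewrite ler_pM//; rewrite (bigD1 i)//= -/(x i).
    by rewrite addrCA lerDl addr_ge0// sumr_ge0.
  by rewrite /s0 invfM -mulrA mulVf ?mulr1 ?div1r// gt_eqF// ltr_pwDl.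
pose l := (ls.1 + s *: v, ls.2 + s *: W).
have Ll : Lambda l.
  split => [i j ij|i] /=; first by rewrite !mxE lC// lW// mulr0 addr0.
  have -> : (ls.2 + s *: W) i i = ls.2 i i * (1 + s * W i i / ls.2 i i).
    by rewrite !mxE; field; rewrite gt_eqF.
  by rewrite mulr_gt0//; have := sx i; rewrite ler_norml => /andP[? _]; lra.
have h1 := opt_real Ll.
have h2 : gaussE (fun t => U (reparam l t)) <= gaussE (fun t => U (reparam ls t)) + s * A + s ^+ 2 * B.
  rewrite /A /B mulrA -!gaussE_Z//; try exact: quad_growth_dot.
  rewrite -!gaussE_D; try (exact: quad_growth_U); try (apply: quad_growthZ; exact: quad_growth_dot).
    apply: gaussE_le; first exact: quad_growth_U.
    - apply: quad_growthD; last by apply: quad_growthZ; exact: quad_growth_dot.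
      by apply: quad_growthD; [exact: quad_growth_U|apply: quad_growthZ; exact: quad_growth_dot].
    - move=> t; have -> : reparam l t = reparam ls t + s *: (W *m vec t + v).
        by rewrite /reparam /l /= mulmxDl -scalemxAl scalerDr addrACA.
      have := smoothU tdU mu0 hessU (reparam ls t) (s *: (W *m vec t + v)).
      rewrite dotZl !dotZr; set q := dot _ _; set r := dot _ _; set w := U _; set w' := U _.
      by have -> : s ^+ 2 * (L / 2) * r = L / 2 * (s * (s * r)) by ring.
  by apply: quad_growthD; [exact: quad_growth_U|apply: quad_growthZ; exact: quad_growth_dot].
have h3 : \sum_i ln (ls.2 i i) + s * \sum_i x i - s ^+ 2 * \sum_i 2 * x i ^+ 2 <= \sum_i ln (l.2 i i).
  rewrite !mulr_sumr -big_split -sumrB; apply: ler_sum => i _ /=.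
  have := ln_add_ge (dpos i) (sx i); rewrite !mxE.
  have -> : s * W i i / ls.2 i i = s * x i by rewrite /x mulrA.
  by have -> : 2 * (s * x i) ^+ 2 = s ^+ 2 * (2 * x i ^+ 2) by ring.
rewrite mulrBr mulrDr; lra.
Qed.

End optimum.

End gaussian_gradient.

(** * One step of the algorithm *)

Section prox.
Context {R : realType} {d : nat}.

(** The positive root of [y^2 - a y - h = 0], that is, the minimizer of
    [- h ln y + (y - a)^2 / 2]. *)
Definition prox1 (h a : R) : R := (a + Num.sqrt (a ^+ 2 + 4 * h)) / 2.

Lemma prox1_gt0 h a : 0 < h -> 0 < prox1 h a.
Proof.
move=> h0; rewrite divr_gt0//.
have : `|a| < Num.sqrt (a ^+ 2 + 4 * h).
  by rewrite -sqrtr_sqr ltr_sqrt ?ltrDl ?mulr_gt0// ltr_wpDl ?sqr_ge0// mulr_gt0.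
by have := ler_norm (- a); rewrite normrN; lra.
Qed.

(** The discriminant is the square of [c + h / c]. By stationarity the diagonal energy gradient at
    the minimizer is [1 / c], so this is its fixed-point property. *)
Lemma prox1_fix h (c : R) : 0 < h -> 0 < c -> prox1 h (c - h / c) = c.
Proof.
move=> h0 c0; rewrite /prox1.
have -> : (c - h / c) ^+ 2 + 4 * h = (c + h / c) ^+ 2 by field; rewrite gt_eqF.
rewrite sqrtr_sqr ger0_norm; last by rewrite addr_ge0// ?divr_ge0// ltW.
by field; rewrite gt_eqF.
Qed.

(** The two square roots satisfy [(A - B) (A + B) = (a - b) (a + b)] with [|a + b| <= A + B], hence
    [|A - B| <= |a - b|]. *)
Lemma prox1_lip h (a b : R) : 0 < h -> (prox1 h a - prox1 h b) ^+ 2 <= (a - b) ^+ 2.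
Proof.
move=> h0; rewrite /prox1.
have gA x : 0 < x ^+ 2 + 4 * h by rewrite ltr_wpDl ?sqr_ge0// mulr_gt0.
have := @sqr_sqrtr R _ (ltW (gA a)); have := @sqr_sqrtr R _ (ltW (gA b)).
have hA : `|a| <= Num.sqrt (a ^+ 2 + 4 * h).
  by rewrite -sqrtr_sqr ler_sqrt ?lerDl ?mulr_ge0// ltW.
have hB : `|b| <= Num.sqrt (b ^+ 2 + 4 * h).
  by rewrite -sqrtr_sqr ler_sqrt ?lerDl ?mulr_ge0// ltW.
have := gA a; rewrite -sqrtr_gt0; have := gA b; rewrite -sqrtr_gt0.
set A := Num.sqrt (a ^+ 2 + _) in hA *; set B := Num.sqrt (b ^+ 2 + _) in hB *.
move=> B0 A0 eB eA.
have e : (A - B) * (A + B) = (a - b) * (a + b) by rewrite -!subr_sqr eA eB; ring.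
have hab : `|a + b| <= A + B by rewrite (le_trans (ler_normD _ _))// lerD.
have AB0 : 0 < A + B by rewrite addr_gt0.
have h1 : `|A - B| <= `|a - b|.
  rewrite -(ler_pM2r AB0) -[in leLHS](ger0_norm (ltW AB0)) -normrM e normrM.
  by rewrite ler_wpM2l.
have -> : (a + A) / 2 - (b + B) / 2 = ((a - b) + (A - B)) / 2 by field.
rewrite -[leLHS]real_normK ?num_real// -[leRHS]real_normK ?num_real//.
rewrite lerXn2r ?nnegrE// normrM [`|2^-1|]ger0_norm// ler_pdivrMr//.
by rewrite (le_trans (ler_normD _ _))// mulr_natr mulr2n lerD2l.
Qed.

End prox.

Lemma param_sqnorm_ge0 {R : realType} {d : nat} (l : @param R d) : 0 <= param_sqnorm l.
Proof.
rewrite addr_ge0//; first by apply: sumr_ge0 => i _; exact: sqr_ge0.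
by apply: sumr_ge0 => i _; apply: sumr_ge0 => j _; exact: sqr_ge0.
Qed.

Lemma dot_sub_scale {R : realType} {d : nat} (u v : 'cV[R]_d) (c : R) :
  dot (u - c *: v) (u - c *: v) = dot u u - 2 * c * dot u v + c ^+ 2 * dot v v.
Proof. by rewrite !(dotBl, dotBr, dotZl, dotZr) (dotC v u); ring. Qed.

Lemma dot_sqr_split {R : realType} {d : nat} (u v : 'cV[R]_d) :
  dot u u <= 2 * dot (u - v) (u - v) + 2 * dot v v.
Proof.
have := dot_ge0 (u - 2 *: v).
rewrite !(dotBl, dotBr, dotZl, dotZr) (dotC v u); lra.
Qed.

Lemma dot_cross {R : realType} {d : nat} (u v w e : 'cV[R]_d) :
  dot e u + dot u w - (dot v w + dot v e) = dot (u - v) (w + e).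
Proof. by rewrite dotBl !dotDr (dotC e); ring. Qed.

Section sum2.
Context {R : realType} {d : nat}.
Implicit Types f : 'I_d -> 'I_d -> R.

Definition sum2 f : R := \sum_i \sum_j f i j.

Lemma sum2_D f1 f2 : sum2 (fun i j => f1 i j + f2 i j) = sum2 f1 + sum2 f2.
Proof. by rewrite -big_split; apply: eq_bigr => i _; rewrite -big_split. Qed.

Lemma sum2_Z (c : R) f : sum2 (fun i j => c * f i j) = c * sum2 f.
Proof. by rewrite mulr_sumr; apply: eq_bigr => i _; rewrite mulr_sumr. Qed.

End sum2.

Section step.
Context {R : realType} {d : nat}.
Local Notation rT := (measurableTypeR R).
Variables (U : 'cV[R]_d -> R) (mu L : R).
Hypothesis tdU : twice_differentiable U.
Hypothesis mu0 : 0 < mu.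
Hypothesis muL : mu <= L.
Hypothesis hessU : forall z v : 'cV[R]_d,
  mu * (v^T *m v) 0 0 <= (v^T *m hess U z *m v) 0 0 /\
  (v^T *m hess U z *m v) 0 0 <= L * (v^T *m v) 0 0.
Variable ls : @param R d.
Hypothesis Lls : Lambda ls.
Hypothesis opt : forall l, Lambda l -> (free_energy U ls <= free_energy U l)%E.
Local Notation g := (grad U).
Implicit Types l : @param R d.

Let L0 : 0 < L := lt_le_trans mu0 muL.

Let D := d%:R : R.
Let gs (t : d.-tuple rT) := g (reparam ls t).
Let lgs : lin_vec gs := lin_vec_grad tdU mu0 L0 hessU ls.

Lemma stationarity_mul (W : 'M[R]_d) : lower_tri W ->
  gaussE (fun t => dot (gs t) (W *m vec t)) = \sum_i W i i / ls.2 i i.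
Proof.
move=> lW; rewrite -(stationarity tdU mu0 L0 hessU Lls opt 0 lW).
by congr gaussE; apply/funext => t; rewrite addr0.
Qed.

Lemma stationarity_cst (v : 'cV[R]_d) : gaussE (fun t => dot (gs t) v) = 0.
Proof.
have l0 : lower_tri (0 : 'M[R]_d) by move=> i j _; rewrite mxE.
have := stationarity tdU mu0 L0 hessU Lls opt v l0.
rewrite big1 => [<-|i _]; last by rewrite mxE mul0r.
by congr gaussE; apply/funext => t; rewrite mul0mx add0r.
Qed.

(** Stationarity tested on [ls.2] itself, where each of the [d] summands is 1. *)
Lemma gaussE_dot_gs_Cs : gaussE (fun t => dot (gs t) (ls.2 *m vec t)) = D.
Proof.
have [lC dpos] := Lls; rewrite stationarity_mul//.
under eq_bigr => i _ do rewrite divff ?gt_eqF//.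
by rewrite sumr_const card_ord.
Qed.

(** Subtracting the gradient at the mean costs nothing because the noise is centred; co-coercivity
    and strong monotonicity apply to the recentred pairing. *)
Lemma gaussE_dot_recentre : gaussE (fun t => dot (gs t - g ls.1) (ls.2 *m vec t)) = D.
Proof.
have lC := lin_vec_mul ls.2; have lc := lin_vec_cst (g ls.1).
under eq_fun do rewrite dotBl.
by rewrite gaussE_B ?gaussE_dot_gs_Cs ?gaussE_dot_mul ?subr0//; exact: quad_growth_dot.
Qed.

(* Variance bounded by the second moment around the gradient at the mean, then co-coercivity. *)
Lemma gaussE_gs_sqr_le : gaussE (fun t => dot (gs t) (gs t)) <= L * D.
Proof.
have lc := lin_vec_cst (g ls.1); have lC := lin_vec_mul ls.2.
have ld := lin_vecB lgs lc.
have q1 := quad_growth_dot lgs lgs; have q2 := quad_growth_dot lgs lc.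
have q3 := quad_growth_dot ld ld; have q4 := quad_growth_dot ld lC.
rewrite -gaussE_dot_recentre -gaussE_Z//.
apply: (@le_trans _ _ (gaussE (fun t => dot (gs t - g ls.1) (gs t - g ls.1)))); last first.
  apply: gaussE_le => //; first exact: quad_growthZ.
  move=> t; have := cocoercive tdU mu0 L0 hessU ls.1 (reparam ls t).
  by rewrite [reparam ls t in X in _ <= X]/reparam addrK.
have e t : dot (gs t - g ls.1) (gs t - g ls.1) =
    dot (gs t) (gs t) - 2 * dot (gs t) (g ls.1) + dot (g ls.1) (g ls.1).
  by rewrite !(dotBl, dotBr) (dotC (g ls.1) (gs t)); ring.
rewrite (funext e).
have q5 := quad_growthZ 2 q2.
rewrite gaussE_D; [|exact: quad_growthB|exact: quad_growth_cst].
rewrite gaussE_B// gaussE_Z// stationarity_cst gaussE_cst mulr0 subr0 lerDl; exact: dot_ge0.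
Qed.

(** Let [v] be the [i]-th column of [ls.2]. Two stationarity tests give mean [c^-1] for the [i]-th
    entry of [H v] and mean 1 for [dot (H v) v]. Since the squared entry is at most
    [L * dot (H v) v], completing a square compares the two means. *)
Lemma diag_inv_sqr_le i : ls.2 i i ^- 2 <= L.
Proof.
have [lC dpos] := Lls; have c0 := dpos i; set c := ls.2 i i in c0 *.
have ld : lower_tri (delta_mx i i : 'M[R]_d).
  move=> j k jk; rewrite mxE; case: eqP => // <-; case: eqP => // e.
  by rewrite e ltnn in jk.
have st j : gaussE (fun t => tnth t i * gs t j 0) = gaussE (fun t => hessC U ls t i j 0).
  by rewrite (gaussE_hessC tdU mu0 L0 hessU).
have q j : quad_growth (fun t => tnth t i * gs t j 0).
  by apply: lin_growth_mul; [exact: lin_growth_tnth|exact: lgs].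
have lh := lin_vec_hessC tdU mu0 L0 hessU ls i.
have lcol := lin_vec_cst (col i ls.2).
have e1 : gaussE (fun t => hessC U ls t i i 0) = c^-1.
  rewrite -st; have := stationarity_mul ld; rewrite (bigD1 i)//= mxE !eqxx div1r.
  rewrite big1 ?addr0 => [<-|j ji]; last by rewrite mxE (negbTE ji) mul0r.
  congr gaussE; apply/funext => t; rewrite /dot (bigD1 i)//= big1 ?addr0 => [|j ji].
    rewrite [(_ *m _) i 0]mxE (bigD1 i)//= big1 ?addr0 => [|k ki].
      by rewrite [delta_mx _ _ _ _]mxE [vec _ _ _]mxE !eqxx mul1r mulrC.
    by rewrite mxE (negbTE ki) andbF mul0r.
  by rewrite [(_ *m _) j 0]mxE big1 ?mulr0// => k _; rewrite mxE (negbTE ji) mul0r.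
have e2 : gaussE (fun t => dot (hessC U ls t i) (col i ls.2)) = 1.
  (* The test matrix keeps only the [i]-th column of [ls.2], so its single nonzero diagonal entry
     contributes [c / c]. *)
  have lW : lower_tri (\matrix_(j, k) (ls.2 j k *+ (k == i)) : 'M[R]_d).
    by move=> j k jk; rewrite mxE lC// mul0rn.
  have := stationarity_mul lW; rewrite (bigD1 i)//= mxE eqxx divff ?gt_eqF//.
  rewrite big1 ?addr0 => [<-|j ji]; last by rewrite mxE (negbTE ji) mul0r.
  rewrite (gaussE_dot_grad_mul tdU mu0 L0 hessU); congr gaussE; apply/funext => t.
  rewrite (bigD1 i)//= big1 ?addr0 => [|j ji].
    by apply: eq_bigr => j _; rewrite !mxE eqxx.
  by apply: big1 => k _; rewrite [col _ _ _ _]mxE mxE (negbTE ji) mulr0.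
have q1 := lin_growth_quad (lh i); have q2 := quad_growth_dot lh lcol.
have cL : c * c^-1 = 1 by rewrite divff ?gt_eqF.
have ic0 : 0 < c^-1 by rewrite invr_gt0.
(* The weight [L * c] is chosen so that the means give [2 * L <= L + (L * c) ^+ 2], that is,
   [1 <= L * c ^+ 2]. *)
have h : gaussE (fun t => (2 * (L * c)) * hessC U ls t i i 0) <=
    gaussE (fun t => L * dot (hessC U ls t i) (col i ls.2) + (L * c) * (L * c)).
  apply: gaussE_le; first exact: quad_growthZ.
    by apply: quad_growthD; [exact: quad_growthZ|exact: quad_growth_cst].
  move=> t; have h1 := hess_sqr_le tdU mu0 L0 hessU (reparam ls t) (col i ls.2).
  have := dot_sqr_le (hessC U ls t i) i; rewrite /hessC in h1 *.
  set a := (_ *m _) i 0; set b := dot (_ *m _) (_ *m _) in h1 *; set w := dot _ _ in h1 *.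
  by move=> ab; have := sqr_ge0 (a - L * c); nra.
have qc : quad_growth (fun _ : d.-tuple rT => L * c * (L * c)) by exact: quad_growth_cst.
have qz := quad_growthZ L q2.
rewrite (gaussE_Z _ q1) e1 (gaussE_D qz qc) (gaussE_Z _ q2) e2 gaussE_cst in h.
have h2 : 1 <= L * c ^+ 2.
  have e : 2 * (L * c) / c = 2 * L by rewrite -mulrA -mulrA cL mulr1.
  rewrite e mulr1 in h.
  have e3 : L * (L * c ^+ 2) = L * c * (L * c) by ring.
  by rewrite -(ler_pM2l L0) e3 mulr1; lra.
by rewrite -[leLHS]mul1r ler_pdivrMr ?exprn_gt0.
Qed.

Section one_step.
Variable l : @param R d.
Hypothesis Ll : Lambda l.
Variable gam : R.
Hypothesis gam0 : 0 < gam.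

Let X := l.2 - ls.2.
Let E := l.1 - ls.1.
Let gl (t : d.-tuple rT) := g (reparam l t).
Let dg t := gl t - gs t.
Let r := param_sqnorm (param_sub l ls).
Let a := gaussE (fun t => dot (dg t) (X *m vec t + E)).
Let lgl : lin_vec gl := lin_vec_grad tdU mu0 L0 hessU l.
Let ldg : lin_vec dg := lin_vecB lgl lgs.

Let lX : lower_tri X.
Proof. by move=> i j ij; rewrite !mxE (Ll.1 i j ij) (Lls.1 i j ij) subrr. Qed.

Let ZE t : reparam l t - reparam ls t = X *m vec t + E.
Proof. by rewrite /reparam /X /E mulmxBl opprD addrACA. Qed.

Let rE : gaussE (fun t => dot (X *m vec t + E) (X *m vec t + E)) = r.
Proof. exact: gaussE_dot_affine_sqr. Qed.

Let X2 := \sum_i \sum_j X i j ^+ 2.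

Let X2_le : 0 <= X2 <= r.
Proof.
apply/andP; split.
  by apply: sumr_ge0 => i _; apply: sumr_ge0 => j _; exact: sqr_ge0.
by rewrite /r /param_sqnorm lerDr sumr_ge0// => i _; exact: sqr_ge0.
Qed.

Lemma strong_mono_gaussE : mu * r <= a.
Proof.
have lw := lin_vec_affine X E.
rewrite -rE -gaussE_Z; last exact: quad_growth_dot.
apply: gaussE_le; [by apply: quad_growthZ; exact: quad_growth_dot|exact: quad_growth_dot|].
move=> t; have := grad_mono tdU hessU (reparam ls t) (reparam l t).
by rewrite ZE => /andP[].
Qed.

Let cross : gaussE (fun t => dot (gs t) (X *m vec t)) = \sum_i X i i / ls.2 i i.
Proof. exact: stationarity_mul. Qed.

(** Young's inequality on each diagonal entry, with [diag_inv_sqr_le] replacing the inverse squares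
    by [L]. *)
Let diag_le : \sum_i X i i / ls.2 i i <= D / 2 + L / 2 * X2.
Proof.
have -> : D / 2 = \sum_(i < d) (2^-1 : R) by rewrite sumr_const card_ord -[RHS]mulr_natr mulrC.
rewrite /X2 mulr_sumr -big_split; apply: ler_sum => i _ /=.
apply: (@le_trans _ _ (2^-1 + L / 2 * X i i ^+ 2)).
  have h := diag_inv_sqr_le i; rewrite -exprVn in h.
  set c := (ls.2 i i)^-1 in h *; set x := X i i.
  have h2 : x ^+ 2 * c ^+ 2 <= x ^+ 2 * L by rewrite ler_wpM2l ?sqr_ge0.
  have := sqr_ge0 (x * c - 1); rewrite sqrrB1 exprMn; lra.
rewrite lerD2l ler_wpM2l ?divr_ge0 ?(ltW L0)// (bigD1 i)//= lerDl.
by apply: sumr_ge0 => j _; exact: sqr_ge0.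
Qed.

(** By Stein's identity this bounds the mean of [tr (C^T H C)], hence the Hessian part of the second
    moment. Writing [gl = dg + gs] and [C = C_s + X] gives four pairings: those with [dg] are
    treated by Young and co-coercivity, those with [gs] by stationarity. *)
Lemma gaussE_dot_gl_C : gaussE (fun t => dot (gl t) (l.2 *m vec t)) <=
  2 * D + 3 / 2 * (L / mu) * a + a / 2.
Proof.
have lw := lin_vec_affine X E; have lXv := lin_vec_mul X; have lC := lin_vec_mul ls.2.
have lc := lin_vec_cst (g ls.1); have lgc := lin_vecB lgs lc.
have qb := quad_growth_dot ldg lw; have q1 := quad_growth_dot lgc lC.
have q2 := quad_growth_dot lXv lXv; have q3 := quad_growth_dot lgs lC.
have q4 := quad_growth_dot lgs lXv.
pose bd t := (L / mu / 2 + 1 / 2) * dot (dg t) (X *m vec t + E) +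
  (1 / 2 * dot (gs t - g ls.1) (ls.2 *m vec t) + (L / 2 * dot (X *m vec t) (X *m vec t) +
   (dot (gs t) (ls.2 *m vec t) + dot (gs t) (X *m vec t)))).
have qbd1 := quad_growthD q3 q4.
have qbd2 := quad_growthD (quad_growthZ (L / 2) q2) qbd1.
have qbd3 := quad_growthD (quad_growthZ (1 / 2) q1) qbd2.
have qbd := quad_growthD (quad_growthZ (L / mu / 2 + 1 / 2) qb) qbd3.
apply: (@le_trans _ _ (gaussE bd)).
  apply: gaussE_le => //; first exact: (quad_growth_dot lgl (lin_vec_mul l.2)).
  move=> t; rewrite /bd.
  have -> : dot (gl t) (l.2 *m vec t) = dot (dg t) (ls.2 *m vec t) + dot (dg t) (X *m vec t)
     + (dot (gs t) (ls.2 *m vec t) + dot (gs t) (X *m vec t)).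
    rewrite -!dotDr -dotDl /dg subrK; congr dot.
    by rewrite -mulmxDl /X addrC subrK.
  have im : 0 < mu^-1 by rewrite invr_gt0.
  have iL : 0 < L^-1 by rewrite invr_gt0.
  (* The weight [mu^-1] leaves [mu |C_s eps|^2], absorbed by strong monotonicity at the mean of
     [ls]; the weight [L^-1] leaves [L |X eps|^2], whose mean is at most [kappa * a]. *)
  have y1 := dot_young (dg t) (ls.2 *m vec t) im.
  have y2 := dot_young (dg t) (X *m vec t) iL.
  rewrite invrK in y1; rewrite invrK in y2.
  have cc := cocoercive tdU mu0 L0 hessU (reparam ls t) (reparam l t).
  rewrite ZE -/(gl t) -/(gs t) -/(dg t) in cc.
  have := grad_mono tdU hessU ls.1 (reparam ls t).
  rewrite [reparam ls t - ls.1]addrK -/(gs t) => /andP[sm _].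
  have c1 : mu^-1 * dot (dg t) (dg t) <= L / mu * dot (dg t) (X *m vec t + E).
    by rewrite [L / mu]mulrC -mulrA ler_pM2l.
  have c2 : L^-1 * dot (dg t) (dg t) <= dot (dg t) (X *m vec t + E).
    by rewrite -(ler_pM2l L0) mulVKf ?gt_eqF.
  have -> : (L / mu / 2 + 1 / 2) * dot (dg t) (X *m vec t + E) =
    (L / mu * dot (dg t) (X *m vec t + E)) / 2 + dot (dg t) (X *m vec t + E) / 2 by field; rewrite gt_eqF.
  have -> : L / 2 * dot (X *m vec t) (X *m vec t) = (L * dot (X *m vec t) (X *m vec t)) / 2 by field.
  lra.
have k0 : 0 <= L / mu by rewrite divr_ge0// ltW.
rewrite /bd gaussE_D//; last exact: quad_growthZ.
rewrite gaussE_D//; last exact: quad_growthZ.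
rewrite gaussE_D//; last exact: quad_growthZ.
rewrite gaussE_D// gaussE_Z// gaussE_Z// gaussE_Z// gaussE_dot_recentre gaussE_dot_gs_Cs cross -/a.
have -> : gaussE (fun t => dot (X *m vec t) (X *m vec t)) = X2.
  have := gaussE_dot_affine_sqr X 0; under eq_fun do rewrite addr0.
  by move=> ->; rewrite big1 ?add0r// => i _; rewrite mxE expr0n.
have := diag_le; have := strong_mono_gaussE; have /andP[x0 xr] := X2_le.
move=> sm dl.
have LX : L * X2 <= L / mu * a.
  rewrite -mulrA ler_pM2l// -(ler_pM2l mu0) mulVKf ?gt_eqF//.
  by rewrite (le_trans _ sm)// ler_pM2l.
have e1 : L / 2 * X2 = L * X2 / 2 by field.
rewrite e1 in dl *.
have -> : (L / mu / 2 + 1 / 2) * a = (L / mu * a) / 2 + a / 2 by field; rewrite gt_eqF.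
have -> : 3 / 2 * (L / mu) * a = 3 / 2 * (L / mu * a) by ring.
lra.
Qed.

Let h t i j := hessC U l t j i 0.
Let Ds i j : R := (ls.2 i i)^-1 *+ (i == j).
Let S := \sum_i (ls.2 i i) ^- 2.
Let x0 := \sum_i X i i / ls.2 i i.

(** A majorant, for each noise value, of the squared distance after one step. The first bracket has
    mean [a], with [x0] coming from the entropy gradient at [ls]; the second majorizes the squared
    deviation of the estimator. *)
Let bnd t := r - 2 * gam * (dot E (gl t) + sum2 (fun i j => h t i j * X i j) - x0) +
  gam ^+ 2 * (2 * (L * dot (dg t) (X *m vec t + E)) + 2 * dot (gs t) (gs t) +
    2 * (L * sum2 (fun i j => h t i j * l.2 i j)) + 2 * S).

Let entry_le t i j : (spgd_step U gam l (vec t)).2 i j - ls.2 i j =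
  (if i == j then prox1 gam (l.2 i i - gam * h t i i) - ls.2 i i
   else X i j - gam * (h t i j *+ (j <= i)%N)).
Proof.
have hE k m : (hess U (l.2 *m vec t + l.1) *m l.2) k m = h t k m.
  by rewrite /h /hessC !mxE; apply: eq_bigr => q _; rewrite [col _ _ _ _]mxE.
rewrite /spgd_step /prox /bonnet_price /=; set H := hess _ _ in hE *.
have tE (M : 'M[R]_d) k m : (l.2 - gam *: tril M) k m = l.2 k m - gam * (M k m *+ (m <= k)%N).
  by rewrite !mxE; case: ifP.
rewrite mxE; case: eqP => [->|_]; first by rewrite tE hE leqnn.
by rewrite tE hE /X [(l.2 - ls.2) i j]mxE [(- ls.2) i j]mxE; ring.
Qed.

(** On the diagonal the iterate is compared with the fixed point of [prox1_fix] by [prox1_lip].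
    Strictly upper entries vanish on the left, yet their [h t i j ^+ 2] stays on the right so that
    whole columns of [H C] are summed, as [hess_sqr_le] requires. *)
Let entry_sqr_le t i j : ((spgd_step U gam l (vec t)).2 i j - ls.2 i j) ^+ 2 <=
  X i j ^+ 2 + - (2 * gam) * (h t i j * X i j) + (2 * gam) * (X i j * Ds i j)
  + (2 * gam ^+ 2) * h t i j ^+ 2 + (2 * gam ^+ 2) * Ds i j ^+ 2.
Proof.
have [lC dpos] := Lls; rewrite entry_le /Ds.
have XE k m : X k m = l.2 k m - ls.2 k m by rewrite mxE [X in _ + X]mxE.
case: eqP => [<-|ij].
  apply: (@le_trans _ _ ((X i i - gam * (h t i i - (ls.2 i i)^-1)) ^+ 2)).
    have := prox1_lip (l.2 i i - gam * h t i i) (ls.2 i i - gam / ls.2 i i) gam0.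
    rewrite prox1_fix//; move/le_trans; apply; rewrite XE.
    by have -> : l.2 i i - ls.2 i i - gam * (h t i i - (ls.2 i i)^-1) =
      l.2 i i - gam * h t i i - (ls.2 i i - gam / ls.2 i i) by ring.
  rewrite mulr1n; set w := _^-1; set y := h t i i; set x := X i i.
  have e : (x - gam * (y - w)) ^+ 2 = x ^+ 2 - 2 * gam * (y * x) + 2 * gam * (x * w) +
    gam ^+ 2 * (y - w) ^+ 2 by ring.
  have e2 : gam ^+ 2 * (y - w) ^+ 2 <= 2 * gam ^+ 2 * y ^+ 2 + 2 * gam ^+ 2 * w ^+ 2.
    have -> : 2 * gam ^+ 2 * y ^+ 2 + 2 * gam ^+ 2 * w ^+ 2 =
      gam ^+ 2 * (y - w) ^+ 2 + gam ^+ 2 * (y + w) ^+ 2 by ring.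
    by rewrite lerDl mulr_ge0// sqr_ge0.
  rewrite e; lra.
rewrite !mulr0n; set y := h t i j; set x := X i j.
have g2 : 0 <= gam ^+ 2 * y ^+ 2 by rewrite mulr_ge0 ?sqr_ge0.
case: (leqP j i) => ji; rewrite ?mulr1n ?mulr0n.
  have -> : (x - gam * y) ^+ 2 = x ^+ 2 - 2 * gam * (y * x) + gam ^+ 2 * y ^+ 2 by ring.
  lra.
have -> : x = 0 by exact: lX.
rewrite !(mulr0, mul0r, subr0, expr0n)/=; lra.
Qed.

Lemma step_le_bnd t : param_sqnorm (param_sub (spgd_step U gam l (vec t)) ls) <= bnd t.
Proof.
rewrite {1}/param_sqnorm.
have -> : \sum_(i < d) (param_sub (spgd_step U gam l (vec t)) ls).1 i 0 ^+ 2 =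
    dot (E - gam *: gl t) (E - gam *: gl t).
  apply: eq_bigr => i _; rewrite -expr2; congr (_ ^+ 2); congr ((_ : 'cV_d) i 0).
  by rewrite /= /E addrAC.
have -> : dot (E - gam *: gl t) (E - gam *: gl t) =
    dot E E - 2 * gam * dot E (gl t) + gam ^+ 2 * dot (gl t) (gl t).
  exact: dot_sub_scale.
have s2 : \sum_(i < d) \sum_(j < d) (param_sub (spgd_step U gam l (vec t)) ls).2 i j ^+ 2 <=
    sum2 (fun i j => X i j ^+ 2 + - (2 * gam) * (h t i j * X i j) + (2 * gam) * (X i j * Ds i j)
  + (2 * gam ^+ 2) * h t i j ^+ 2 + (2 * gam ^+ 2) * Ds i j ^+ 2).
  apply: ler_sum => i _; apply: ler_sum => j _.
  by rewrite /param_sub [X in X ^+ 2 <= _]mxE [(- ls.2) i j]mxE; exact: entry_sqr_le.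
rewrite !sum2_D !sum2_Z in s2.
have eDs : sum2 (fun i j => Ds i j ^+ 2) = S.
  apply: eq_bigr => i _; rewrite (bigD1 i)//= /Ds eqxx mulr1n exprVn big1 ?addr0// => j ji.
  by rewrite eq_sym (negbTE ji) mulr0n expr0n.
have ex0 : sum2 (fun i j => X i j * Ds i j) = x0.
  apply: eq_bigr => i _; rewrite (bigD1 i)//= /Ds eqxx mulr1n big1 ?addr0// => j ji.
  by rewrite eq_sym (negbTE ji) mulr0n mulr0.
rewrite eDs ex0 in s2.
have er : r = dot E E + sum2 (fun i j => X i j ^+ 2).
  by congr (_ + _); apply: eq_bigr => i _; rewrite expr2.
(* Summed by columns, this is [hess_sqr_le] for each column of [H C]. *)
have hh : sum2 (fun i j => h t i j ^+ 2) <= L * sum2 (fun i j => h t i j * l.2 i j).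
  rewrite /sum2 exchange_big [X in _ <= L * X]exchange_big mulr_sumr; apply: ler_sum => j _ /=.
  have := hess_sqr_le tdU mu0 L0 hessU (reparam l t) (col j l.2); rewrite -/(hessC U l t j).
  have -> : dot (hessC U l t j) (hessC U l t j) = \sum_i h t i j ^+ 2.
    by apply: eq_bigr => i _; rewrite expr2.
  suff -> : dot (hessC U l t j) (col j l.2) = \sum_i h t i j * l.2 i j by [].
  by apply: eq_bigr => i _; rewrite [col _ _ _ _]mxE.
have gg : dot (gl t) (gl t) <= 2 * (L * dot (dg t) (X *m vec t + E)) + 2 * dot (gs t) (gs t).
  have := cocoercive tdU mu0 L0 hessU (reparam ls t) (reparam l t).
  rewrite ZE -/(gl t) -/(gs t) -/(dg t).
  have := dot_sqr_split (gl t) (gs t); rewrite -/(dg t); lra.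
have g20 := sqr_ge0 gam.
have h1 := ler_wpM2l g20 hh; have h2 := ler_wpM2l g20 gg.
rewrite /bnd er.
move: h1 h2 s2.
set s3 := sum2 _; set s4 := sum2 _; set s5 := sum2 _; set s6 := sum2 _.
set b1 := dot (dg t) _; set b2 := dot (gs t) _; set b3 := dot (gl t) _.
set G2 := gam ^+ 2; set q := \sum_(i < d) _ => h1 h2 s2.
have e1 : G2 * (2 * (L * b1) + 2 * b2 + 2 * (L * s4) + 2 * S) =
  G2 * (2 * (L * b1) + 2 * b2) + 2 * (G2 * (L * s4)) + 2 * G2 * S by ring.
rewrite e1; lra.
Qed.

Let S_le : S <= L * D.
Proof.
have -> : L * D = \sum_(i < d) L by rewrite sumr_const card_ord mulr_natr.
by apply: ler_sum => i _; exact: diag_inv_sqr_le.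
Qed.

Let qh i j : quad_growth (fun t => h t i j).
Proof. by apply: lin_growth_quad; exact: (lin_vec_hessC tdU mu0 L0 hessU l j). Qed.

Let qsum2 (W : 'M[R]_d) : quad_growth (fun t => sum2 (fun i j => h t i j * W i j)).
Proof.
apply: quad_growth_sum => i; apply: quad_growth_sum => j.
have := quad_growthZ (W i j) (qh i j).
by under eq_fun do rewrite mulrC.
Qed.

Let Esum2 (W : 'M[R]_d) : gaussE (fun t => sum2 (fun i j => h t i j * W i j)) =
  gaussE (fun t => dot (gl t) (W *m vec t)).
Proof.
rewrite (gaussE_dot_grad_mul tdU mu0 L0 hessU); congr gaussE; apply/funext => t.
rewrite /sum2 exchange_big; apply: eq_bigr => j _; apply: eq_bigr => i _.
by rewrite [col _ _ _ _]mxE.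
Qed.

(** Stated for an affine function of the squared distance because such majorants are stable under
    iteration. *)
Lemma step_gaussE (A B : R) : 0 <= A -> 0 <= B -> gam <= (10 * L * (L / mu))^-1 ->
  (std_gauss_E (fun e => (A * param_sqnorm (param_sub (spgd_step U gam l e) ls) + B)%:E) <=
   (A * ((1 - gam * mu) * r + 8 * gam ^+ 2 * L * D) + B)%:E)%E.
Proof.
move=> A0 B0 gle.
have lw := lin_vec_affine X E; have lE := lin_vec_cst E.
have q1 := quad_growth_dot lE lgl; have q2 := qsum2 X; have q3 := quad_growth_dot ldg lw.
have q4 := quad_growth_dot lgs lgs; have q5 := qsum2 l.2.
have c1 := quad_growth_cst (n := d) x0; have c2 := quad_growth_cst (n := d) (2 * S).
have c3 := quad_growth_cst (n := d) r; have c4 := quad_growth_cst (n := d) B.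
have q12 := quad_growthD q1 q2; have q12x := quad_growthB q12 c1.
have q12z := quad_growthZ (2 * gam) q12x; have qr := quad_growthB c3 q12z.
have z3 := quad_growthZ L q3; have z3' := quad_growthZ 2 z3; have z4 := quad_growthZ 2 q4.
have z5 := quad_growthZ L q5; have z5' := quad_growthZ 2 z5.
have q34 := quad_growthD z3' z4; have q345 := quad_growthD q34 z5'.
have q3456 := quad_growthD q345 c2; have qz := quad_growthZ (gam ^+ 2) q3456.
have qb : quad_growth bnd := quad_growthD qr qz.
have qAb := quad_growthZ A qb; have qAB := quad_growthD qAb c4.
have Eb : gaussE bnd <= (1 - gam * mu) * r + 8 * gam ^+ 2 * L * D.
  rewrite /bnd (gaussE_D qr qz) (gaussE_B c3 q12z) (gaussE_Z _ q12x) (gaussE_B q12 c1) (gaussE_D q1 q2).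
  rewrite (gaussE_Z _ q3456) (gaussE_D q345 c2) (gaussE_D q34 z5') (gaussE_D z3' z4).
  rewrite (gaussE_Z _ z3) (gaussE_Z _ q3) (gaussE_Z _ q4) (gaussE_Z _ z5) (gaussE_Z _ q5) !gaussE_cst !Esum2.
  rewrite -/a.
  (* Stationarity rewrites [x0] as a mean of [gs] against [X eps], and [gs] has mean zero against
     the constant [E], so the bracket becomes [dg] paired with [X eps + E]. *)
  have ea : gaussE (fun t => dot E (gl t)) + gaussE (fun t => dot (gl t) (X *m vec t)) - x0 = a.
    have lXv := lin_vec_mul X.
    have -> : x0 = gaussE (fun t => dot (gs t) (X *m vec t)) + gaussE (fun t => dot (gs t) E).
      by rewrite cross stationarity_cst addr0.
    have p1 := quad_growth_dot lgl lXv; have p2 := quad_growth_dot lgs lXv.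
    have p3 := quad_growth_dot lgs lE.
    rewrite -gaussE_D// -gaussE_D// -gaussE_B; [|exact: quad_growthD|exact: quad_growthD].
    by congr gaussE; apply/funext => t; exact: dot_cross.
  rewrite ea.
  have h1 := gaussE_gs_sqr_le; have h2 := gaussE_dot_gl_C; have h3 := S_le.
  have h4 := strong_mono_gaussE.
  have k0 : 0 <= L / mu by rewrite divr_ge0// ltW.
  have k1 : 1 <= L / mu by rewrite ler_pdivlMr// mul1r.
  have r0 : 0 <= r by have /andP[] := X2_le; exact: le_trans.
  have a0 : 0 <= a by apply: le_trans h4; rewrite mulr_ge0// ltW.
  have g1 : gam * (10 * L * (L / mu)) <= 1.
    have den : 0 < 10 * L * (L / mu) by rewrite !mulr_gt0 ?invr_gt0.
    by rewrite -ler_pdivlMr// div1r.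
  move: h1 h2 h3 h4 g1; set N := gaussE (fun t => dot (gs t) (gs t)).
  set hc := gaussE (fun t => dot (gl t) (l.2 *m vec t)); set k := L / mu in k0 k1 *.
  move=> h1 h2 h3 h4 g1.
  have LD : 0 <= L * D by apply: mulr_ge0; [exact: ltW|exact: ler0n].
  have La : 0 <= L * a by rewrite mulr_ge0// ltW.
  (* The noise constant 8 is 2 from [N], 4 from [hc] and 2 from [S]. The terms in [a] add up to
     [3 L a + 3 L k a], and [k >= 1]. *)
  have b1 : 2 * (L * a) + 2 * N + 2 * (L * hc) + 2 * S <= 6 * (L * k * a) + 8 * (L * D).
    have := ler_wpM2l (ltW L0) h2.
    have -> : L * (2 * D + 3 / 2 * k * a + a / 2) = 2 * (L * D) + 3 / 2 * (L * k * a) + L * a / 2 by field.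
    have : L * a <= L * k * a by rewrite mulrAC ler_peMr.
    lra.
  have := ler_wpM2l (sqr_ge0 gam) b1.
  (* The step bound reduces [6 gam^2 L k a] to at most [3/5 gam a]. Out of the descent [2 gam a]
     more than [gam a] survives, which strong monotonicity converts into [gam mu r]. *)
  have -> : gam ^+ 2 * (6 * (L * k * a) + 8 * (L * D)) =
    gam * a * (3 / 5) * (gam * (10 * L * k)) + 8 * gam ^+ 2 * L * D by field.
  have ga0 : 0 <= gam * a by rewrite mulr_ge0// ltW.
  have b3 : gam * a * (3 / 5) * (gam * (10 * L * k)) <= gam * a * (3 / 5).
    by rewrite ler_piMr// mulr_ge0.
  have b4 : gam * (mu * r) <= gam * a by rewrite ler_pM2l.
  have -> : (1 - gam * mu) * r = r - gam * (mu * r) by ring.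
  have -> : 2 * gam * a = 2 * (gam * a) by ring.
  lra.
apply: (@le_trans _ _ (gaussE (fun t => A * bnd t + B))%:E); last first.
  by rewrite lee_fin (gaussE_D qAb c4) (gaussE_Z _ qb) gaussE_cst lerD2r ler_wpM2l.
have eB : (fun t : d.-tuple rT => A * bnd (to_tuple (vec t)) + B) = (fun t => A * bnd t + B).
  by apply/funext => t; rewrite vecK.
rewrite -[X in (_ <= (gaussE X)%:E)%E]eB -(@std_gauss_E_quad R d (fun e => A * bnd (to_tuple e) + B)); last by rewrite eB.
apply: std_gauss_E_le => e; rewrite lee_fin.
  by rewrite addr_ge0 ?mulr_ge0 ?param_sqnorm_ge0.
have hst := step_le_bnd (to_tuple e); rewrite (to_tupleK e) in hst.
by rewrite lerD2r; exact: (ler_wpM2l A0 hst).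
Qed.

End one_step.

End step.

(** * The scalar recursion *)

Section rates.
Context {R : realType}.

(** The scaled recursion taken with equality: [h] stands for [mu * gamma] and [K] for
    [kappa * d]. *)
Fixpoint noisy_contraction (h : nat -> R) (K R0 : R) (t : nat) : R :=
  if t is t'.+1 then
    (1 - h t') * noisy_contraction h K R0 t' + 8 * h t' ^+ 2 * K
  else R0.

Local Notation Rseq := noisy_contraction.

(** Provides the switching time. Minimality later gives [tstar <= T], and the upper bound limits the
    weight with which the second phase starts. *)
Lemma least_nat_ge (x : R) : 0 <= x ->
  exists n : nat, [/\ x <= n%:R, n%:R < x + 1 & forall m : nat, x <= m%:R -> (n <= m)%N].
Proof.
move=> x0; have ex : exists n : nat, x <= n%:R.
  by exists (Num.truncn x).+1; apply: ltW; exact: truncnS_gt.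
case: (ex_minnP ex) => n xn min; exists n; split => //.
case: n xn min => [_ _|n xn min]; first by rewrite ltr_wpDl.
rewrite -natr1 ltrD2r ltNge; apply/negP => /min.
by rewrite ltnn.
Qed.

Lemma one_sub_expn_le (h : R) (t : nat) : 0 <= h <= 1 -> (1 - h) ^+ t <= expR (- (h * t%:R)).
Proof.
move=> /andP[h0 h1]; rewrite -mulNr mulrC expRM_natl.
by rewrite lerXn2r ?nnegrE ?subr_ge0 ?expR_ge0// expR_ge1Dx.
Qed.

(** At constant step [h0] the recursion has the fixed point [8 * h0 * K], and the deviation from it
    decays geometrically. *)
Lemma stage1 (h : nat -> R) (K R0 h0 : R) (tstar : nat) : 0 <= h0 <= 1 ->
  (forall t, (t < tstar)%N -> h t = h0) ->
  forall t, (t <= tstar)%N ->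
  Rseq h K R0 t - 8 * h0 * K = (1 - h0) ^+ t * (R0 - 8 * h0 * K).
Proof.
move=> h01 hh; elim => [_|t IH tt] /=; first by rewrite expr0 mul1r.
by rewrite hh// [(1 - h0) ^+ t.+1]exprS -[RHS]mulrA -(IH (ltnW tt)); ring.
Qed.

(** The step is designed so that [(s + 1)^2 (1 - h) = s^2], which makes the weighted error
    telescope; each noise contribution is [8 K ((2 s + 1) / (s + 1))^2 <= 32 K]. *)
Lemma stage2 (h : nat -> R) (K R0 : R) (tstar : nat) (tau : R) : 0 <= tau -> 0 <= K ->
  (forall t, (tstar <= t)%N -> h t = (2 * (t%:R + tau) + 1) / (t%:R + tau + 1) ^+ 2) ->
  forall n, ((tstar + n)%:R + tau) ^+ 2 * Rseq h K R0 (tstar + n)%N <=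
    (tstar%:R + tau) ^+ 2 * Rseq h K R0 tstar + 32 * K * n%:R.
Proof.
move=> tau0 K0 hh; elim => [|n IH]; first by rewrite addn0 mulr0 addr0.
rewrite addnS /= hh ?leq_addr//; move: IH.
set s := (tstar + n)%:R + tau; set Rn := Rseq _ _ _ _; set C := (tstar%:R + tau) ^+ 2 * _ => IH.
have s0 : 0 <= s by rewrite addr_ge0.
have -> : (tstar + n).+1%:R + tau = s + 1 by rewrite -natr1 /s; ring.
have -> : C + 32 * K * n.+1%:R = (C + 32 * K * n%:R) + 32 * K by rewrite -natr1; ring.
have s1 : s + 1 != 0 by rewrite gt_eqF// ltr_wpDl.
have -> : (s + 1) ^+ 2 * ((1 - (2 * s + 1) / (s + 1) ^+ 2) * Rn + 8 * ((2 * s + 1) / (s + 1) ^+ 2) ^+ 2 * K)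
  = s ^+ 2 * Rn + 8 * K * ((2 * s + 1) / (s + 1)) ^+ 2 by field.
rewrite lerD// (_ : 32 * K = 8 * K * 4); last by ring.
rewrite ler_wpM2l ?mulr_ge0//.
have q0 : 0 <= (2 * s + 1) / (s + 1) by rewrite divr_ge0 ?addr_ge0 ?mulr_ge0.
have q2 : (2 * s + 1) / (s + 1) <= 2 by rewrite ler_pdivrMr ?ltr_wpDl//; lra.
nra.
Qed.

(** The next value is a convex combination of the current one and [8 * h t * K], so any level above
    both is preserved. *)
Lemma contraction_le (h : nat -> R) (K R0 B : R) (t0 : nat) : 0 <= B -> 0 <= K ->
  (forall t, (t0 <= t)%N -> 0 <= h t <= 1) ->
  (forall t, (t0 <= t)%N -> 8 * h t * K <= B) -> Rseq h K R0 t0 <= B ->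
  forall n, Rseq h K R0 (t0 + n)%N <= B.
Proof.
move=> B0 K0 h01 hB RB; elim => [|n IH]; first by rewrite addn0.
rewrite addnS /=; have /andP[h0 h1] := h01 _ (leq_addr n t0).
have := hB _ (leq_addr n t0); set q := h _ in h0 h1 *; set r := Rseq _ _ _ _ in IH *.
move=> qB; have : (1 - q) * r <= (1 - q) * B by rewrite ler_wpM2l// subr_ge0.
have : q * (8 * q * K) <= q * B by rewrite ler_wpM2l.
have -> : 8 * q ^+ 2 * K = q * (8 * q * K) by ring.
lra.
Qed.

Lemma poly_step_bound (s : R) : 0 <= s ->
  0 < (2 * s + 1) / (s + 1) ^+ 2 <= 2 / (s + 1).
Proof.
move=> s0; have s1 : 0 < s + 1 by rewrite ltr_wpDl.
apply/andP; split.
  by rewrite divr_gt0 ?exprn_gt0// ltr_wpDl// mulr_ge0.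
rewrite ler_pdivrMr ?exprn_gt0//.
have -> : 2 / (s + 1) * (s + 1) ^+ 2 = 2 * (s + 1) by field; rewrite gt_eqF.
lra.
Qed.

Lemma ln_ge_one_sub_inv (y : R) : 0 < y -> 1 - y^-1 <= ln y.
Proof.
move=> y0; have yi : 0 < y^-1 by rewrite invr_gt0.
have := @le_ln1Dx R (y^-1 - 1); rewrite subrKC lnV ?posrE// => h.
by have := h ltac:(lra); lra.
Qed.

(* [ln w <= w / e] and [e >= 9 / 4]. *)
Lemma ln_le_slope (w : R) : 0 < w -> ln w <= 4 / 9 * w.
Proof.
move=> w0; pose E := expR (1 : R).
have E0 : 0 < E by exact: expR_gt0.
have E94 : 9 / 4 <= E.
  have e : E = expR (1 / 2) * expR (1 / 2) by rewrite -expRD /E; congr expR; field.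
  have x1 := expR_ge1Dx (1 / 2 : R); rewrite e.
  have -> : 9 / 4 = (1 + 1 / 2) * (1 + 1 / 2) :> R by field.
  by rewrite ler_pM// addr_ge0.
have q0 : 0 < w / E by rewrite divr_gt0.
have := ln_ge_one_sub_inv (y := (w / E)^-1); rewrite invr_gt0 => /(_ q0).
rewrite invrK lnV ?posrE// ln_div ?posrE// expRK => h.
have : w / E <= 4 / 9 * w.
  by rewrite ler_pdivrMr//; have := ler_wpM2l (ltW w0) E94; lra.
lra.
Qed.

(** [ln_le_slope] at the inverse square root of [y]. A constant below 1 is what allows a negative
    logarithm to be absorbed in [rate_mid]. *)
Lemma neg_ln_le (y : R) : 0 < y -> - ln y <= 8 / 9 * (Num.sqrt y)^-1.
Proof.
move=> y0; have s0 : 0 < Num.sqrt y by rewrite sqrtr_gt0.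
have := @ln_le_slope (Num.sqrt y)^-1; rewrite invr_gt0 => /(_ s0).
rewrite lnV ?posrE//; have -> : ln y = 2 * ln (Num.sqrt y).
  by rewrite -{1}(sqr_sqrtr (ltW y0)) expr2 lnM ?posrE//; ring.
lra.
Qed.

(** The schedule multiplied by [mu], which depends on [mu] and [L] only through [kappa]. *)
Definition scaled_schedule (kappa : R) (tstar : nat) (tau : R) (t : nat) : R :=
  if (t < tstar)%N then (10 * kappa ^+ 2)^-1
  else (2 * (t%:R + tau) + 1) / (t%:R + tau + 1) ^+ 2.

Lemma scaled_schedule_lt (kappa : R) (tstar : nat) (tau : R) (t : nat) : (t < tstar)%N ->
  scaled_schedule kappa tstar tau t = (10 * kappa ^+ 2)^-1.
Proof. by rewrite /scaled_schedule => ->. Qed.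

Lemma scaled_schedule_ge (kappa : R) (tstar : nat) (tau : R) (t : nat) : (tstar <= t)%N ->
  scaled_schedule kappa tstar tau t = (2 * (t%:R + tau) + 1) / (t%:R + tau + 1) ^+ 2.
Proof. by rewrite /scaled_schedule ltnNge => ->. Qed.

(** Second-phase steps are at most [2 / (s + 1)] with [s >= tau], so [tau >= 20 kappa^2] makes them
    respect the step restriction of the first phase. *)
Lemma scaled_schedule_bounds (kappa : R) (tstar : nat) (tau : R) (t : nat) : 1 <= kappa -> 20 * kappa ^+ 2 <= tau ->
  0 < scaled_schedule kappa tstar tau t <= (10 * kappa ^+ 2)^-1.
Proof.
move=> k1 ht; have k2 : 1 <= kappa ^+ 2 by rewrite exprn_ege1.
have p : 0 < 10 * kappa ^+ 2 by lra.
rewrite /scaled_schedule; case: ifP => _; first by rewrite invr_gt0 p lexx.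
have t0 : (0 : R) <= t%:R by exact: ler0n.
have s0 : 0 <= t%:R + tau by lra.
have /andP[h1 h2] := poly_step_bound s0; rewrite h1/=.
apply: (le_trans h2); rewrite ler_pdivrMr; last by lra.
by rewrite mulrC ler_pdivlMr//; lra.
Qed.

Definition complexity (d : nat) (kappa Delta2 eps : R) : R :=
  d%:R * kappa / eps
  + Num.sqrt d%:R * (kappa * Num.sqrt kappa) * ln (kappa * Delta2) / Num.sqrt eps
  + kappa ^+ 2 * ln (Delta2 / eps).

(** * Choice of switching time and shift, by cases on the initial error and the accuracy *)

Section cases.
Variables (d : nat) (kappa Delta2 eps : R).
Hypothesis d1 : (0 < d)%N.
Hypothesis k1 : 1 <= kappa.
Hypothesis eps0 : 0 < eps.
Let D := d%:R : R.
Let K := kappa * D.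
Let D1 : 1 <= D. Proof. by rewrite ler1n. Qed.
Let k0 : 0 < kappa. Proof. exact: lt_le_trans k1. Qed.
Let k2 : 1 <= kappa ^+ 2. Proof. by rewrite exprn_ege1. Qed.
Let K0 : 0 <= K. Proof. by rewrite mulr_ge0// ltW. Qed.
Let p10 : 0 < 10 * kappa ^+ 2. Proof. by rewrite mulr_gt0// exprn_gt0. Qed.
Let h0 := (10 * kappa ^+ 2)^-1.
Let h00 : 0 < h0. Proof. by rewrite invr_gt0. Qed.
Let h01 : h0 <= 1.
Proof. by rewrite invf_le1 //; have := k2; lra. Qed.
Let hle01 : 0 <= h0 <= 1. Proof. by rewrite (ltW h00) h01. Qed.
(** The stationary noise level of the constant-step phase. *)
Let N0 : 8 * h0 * K = 4 / 5 * (D / kappa).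
Proof. by rewrite /h0 /K; field; rewrite gt_eqF. Qed.

Let goal tstar tau := forall T : nat, 1000 * complexity d kappa Delta2 eps <= T%:R ->
  Rseq (scaled_schedule kappa tstar tau) K Delta2 T <= eps.

Let scaled_schedule01 tstar tau t : 20 * kappa ^+ 2 <= tau -> 0 <= scaled_schedule kappa tstar tau t <= 1.
Proof.
move=> ht; have /andP[a b] := scaled_schedule_bounds tstar t k1 ht.
by rewrite (ltW a)/= (le_trans b).
Qed.

(** The error starts below [eps], and a large [tau] keeps it there for every [T]: the noise level
    [8 h K] is at most [16 K / tau <= eps]. *)
Lemma rate_small : Delta2 <= eps -> exists tau, 20 * kappa ^+ 2 <= tau /\ goal 0 tau.
Proof.
move=> De; exists (20 * kappa ^+ 2 + 16 * K / eps).
have q0 : 0 <= 16 * K / eps by rewrite divr_ge0 ?mulr_ge0// ltW.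
have ht : 20 * kappa ^+ 2 <= 20 * kappa ^+ 2 + 16 * K / eps by rewrite lerDl.
split => // T _; apply: (@contraction_le _ K Delta2 eps 0%N) => //; first exact: ltW.
  by move=> t _; exact: scaled_schedule01.
move=> t _; rewrite /scaled_schedule ltn0 /=; set tau := 20 * kappa ^+ 2 + _.
have t0 : (0 : R) <= t%:R by exact: ler0n.
have tau0 : 16 * K / eps <= tau by rewrite /tau; have := k2; lra.
have s0 : 0 <= t%:R + tau by lra.
have /andP[_ h2] := poly_step_bound s0.
have K8 : 0 <= 8 * K by exact: mulr_ge0.
move: h2; set q := (2 * _ + 1) / _ => h2; have -> : 8 * q * K = 8 * K * q by ring.
apply: (le_trans (ler_wpM2l K8 h2)).
rewrite mulrA ler_pdivrMr; last by lra.
have : 16 * K <= eps * tau by rewrite [eps * _]mulrC -ler_pdivrMr.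
have : 0 <= eps * (t%:R + 1) by rewrite mulr_ge0 ?(ltW eps0)// addr_ge0.
have -> : eps * (t%:R + tau + 1) = eps * tau + eps * (t%:R + 1) by ring.
lra.
Qed.

Hypothesis De : eps < Delta2.
Let y0 : 0 < Delta2. Proof. exact: lt_trans De. Qed.
Let ln_ratio : 0 <= ln (Delta2 / eps).
Proof. by apply: ln_ge0; rewrite ler_pdivlMr// mul1r ltW. Qed.

Let term1 : 0 <= D * kappa / eps.
Proof. by rewrite divr_ge0 ?mulr_ge0// ltW. Qed.

Let term3 : 0 <= kappa ^+ 2 * ln (Delta2 / eps).
Proof. by rewrite mulr_ge0// sqr_ge0. Qed.

Let term2 : 1 <= kappa * Delta2 ->
  0 <= Num.sqrt D * (kappa * Num.sqrt kappa) * ln (kappa * Delta2) / Num.sqrt eps.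
Proof.
move=> kD; rewrite divr_ge0 ?sqrtr_ge0// mulr_ge0 ?ln_ge0//.
by rewrite !mulr_ge0 ?sqrtr_ge0// ltW.
Qed.

(** The noise level of the constant-step phase is at most [4/5 eps], so that phase alone reaches
    [eps], and the smaller steps that follow preserve it. *)
Lemma rate_large_eps : D / kappa <= eps -> exists tstar, goal tstar (20 * kappa ^+ 2).
Proof.
move=> eD; have x0 : 0 <= 50 * (kappa ^+ 2 * ln (Delta2 / eps)) by rewrite mulr_ge0.
have [tstar [tx _ tmin]] := least_nat_ge x0.
exists tstar => T; rewrite /complexity => hT.
have kD : 1 <= kappa * Delta2.
  have : D <= kappa * eps by rewrite [kappa * _]mulrC -ler_pdivrMr.
  have : kappa * eps <= kappa * Delta2 by rewrite ler_pM2l// ltW.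
  have := D1; lra.
have tT : (tstar <= T)%N.
  by apply: tmin; have := term2 kD; have := term1; have := term3; rewrite /D in eD *; lra.
have NN : 8 * h0 * K <= 4 / 5 * eps by rewrite N0 ler_pM2l//; lra.
have st1 : Rseq (scaled_schedule kappa tstar (20 * kappa ^+ 2)) K Delta2 tstar <= eps.
  have e := stage1 K Delta2 hle01 (@scaled_schedule_lt kappa tstar (20 * kappa ^+ 2)) (leqnn tstar).
  rewrite -/h0 in e.
  set y := Delta2 / eps.
  have y1 : 1 <= y by rewrite /y ler_pdivlMr// mul1r ltW.
  (* The factor 50 in the switching time gives [h0 * tstar >= 5 ln y], hence a contraction by
     [y^-5]. *)
  have py : (1 - h0) ^+ tstar * y ^+ 5 <= 1.
    have le1 := one_sub_expn_le tstar hle01.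
    have le2 : expR (- (h0 * tstar%:R)) <= expR (- (ln y *+ 5)).
      rewrite ler_expR lerN2 mulrC ler_pdivlMr//.
      by apply: le_trans tx; rewrite /y -mulr_natr; lra.
    rewrite expRN -[ln y *+ 5]mulr_natl expRM_natl lnK ?posrE in le2; last by lra.
    rewrite -ler_pdivlMr ?div1r ?exprn_gt0//; last by lra.
    exact: le_trans le1 le2.
  (* The tangent-line bound [5 y - 4 <= y^5]. The exponent 5 matches the margin of one fifth between
     the noise level and [eps]. *)
  have yB : y - 4 / 5 <= y ^+ 5 / 5.
    have y2 : 2 * y - 1 <= y ^+ 2 by have := sqr_ge0 (y - 1); nra.
    have y4 : 2 * y ^+ 2 - 1 <= y ^+ 4 by have := sqr_ge0 (y ^+ 2 - 1); nra.
    have : y * (2 * y ^+ 2 - 1) <= y ^+ 5 by rewrite [y ^+ 5]exprS ler_wpM2l//; lra.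
    have : y * (2 * y - 1) <= y * y ^+ 2 by rewrite ler_wpM2l//; lra.
    have := sqr_ge0 (y - 1); nra.
  have p0 : 0 <= (1 - h0) ^+ tstar by rewrite exprn_ge0// subr_ge0.
  have : (1 - h0) ^+ tstar * (y - 4 / 5) <= 1 / 5.
    apply: (@le_trans _ _ ((1 - h0) ^+ tstar * (y ^+ 5 / 5))); first by rewrite ler_wpM2l.
    by rewrite mulrA; lra.
  have Dy : Delta2 = y * eps by rewrite /y divfK// gt_eqF.
  set P := (1 - h0) ^+ tstar in e p0 *.
  have P1 : P <= 1 by rewrite exprn_ile1// ?subr_ge0// lerBlDr lerDl ltW.
  move=> hP; set RR := noisy_contraction _ _ _ _ in e *.
  set NV := 8 * h0 * K in e NN *.
  have -> : RR = P * Delta2 + (1 - P) * NV by rewrite mulrBl mul1r; lra.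
  have : (1 - P) * NV <= (1 - P) * (4 / 5 * eps) by rewrite ler_wpM2l// subr_ge0.
  have := ler_wpM2r (ltW eps0) hP; rewrite Dy.
  have -> : P * (y - 4 / 5) * eps = P * (y * eps) - P * (4 / 5 * eps) by ring.
  lra.
rewrite -(subnKC tT); apply: contraction_le => //; first exact: ltW.
  by move=> t _; exact: scaled_schedule01.
move=> t _; have /andP[_ hb] := scaled_schedule_bounds tstar t k1 (lexx (20 * kappa ^+ 2)).
apply: (@le_trans _ _ (8 * h0 * K)); first by rewrite ler_wpM2r// ler_wpM2l.
by apply: (le_trans NN); have := eps0; lra.
Qed.

(** Half of [eps] pays for the error carried over from the switching time, the other half for the
    accumulated noise. *)
Lemma final_bound (A B T : R) : 0 < T -> T ^+ 2 * A <= B + 32 * K * T ->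
  B <= T ^+ 2 * (eps / 2) -> 64 * K <= eps * T -> A <= eps.
Proof.
move=> T0 h1 h2 h3; have T2 : 0 < T ^+ 2 by rewrite exprn_gt0.
rewrite -(ler_pM2l T2) (le_trans h1)//.
have := ler_wpM2r (ltW T0) h3.
have -> : 64 * K * T = 2 * (32 * K * T) by ring.
have -> : eps * T * T = T ^+ 2 * eps by ring.
rewrite mulrA in h2.
lra.
Qed.

Hypothesis eD : eps < D / kappa.

Let q := D * kappa / eps.

Let q_ge : kappa ^+ 2 <= q.
Proof.
rewrite /q ler_pdivlMr// expr2 -mulrA mulrC ler_pM2r// mulrC.
by rewrite -ler_pdivlMr// ltW.
Qed.

Let eq_q : eps * q = D * kappa.
Proof. by rewrite /q mulrC divfK// gt_eqF. Qed.

(** The initial error is at most [4 / kappa], already of the order of the noise level, so the second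
    phase starts at once. *)
Lemma rate_mid : kappa * Delta2 <= 4 -> goal 0 (20 * kappa ^+ 2).
Proof.
move=> kD4 T; rewrite /complexity => hT.
have y1 : 0 < kappa * Delta2 by rewrite mulr_gt0.
(* The logarithm can be negative, but [Delta2 > eps] bounds its term below by [- 8/9 q]. A ninth of
   [q] survives, and the constant 1000 turns it into [T >= 100 q]. *)
have t2 : - (8 / 9 * q) <= Num.sqrt D * (kappa * Num.sqrt kappa) * ln (kappa * Delta2) / Num.sqrt eps.
  have se0 : 0 < Num.sqrt eps by rewrite sqrtr_gt0.
  have sk0 : 0 < Num.sqrt kappa by rewrite sqrtr_gt0.
  have sD0 : 0 <= Num.sqrt D by exact: sqrtr_ge0.
  have sDD : Num.sqrt D <= D.
    have := sqr_sqrtr (ler0n R d); have : 1 <= Num.sqrt D by rewrite -[leLHS]sqrtr1 ler_sqrt// ltW// ltr0n.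
    by rewrite -/D; move=> h e; rewrite -[leRHS]e expr2 ler_peMl.
  have h1 := neg_ln_le y1.
  have h2 : (Num.sqrt (kappa * Delta2))^-1 <= (Num.sqrt kappa * Num.sqrt eps)^-1.
    rewrite lef_pV2 ?posrE ?sqrtr_gt0 ?mulr_gt0// -sqrtrM ?(ltW k0)//.
    by rewrite ler_sqrt ?(ltW y1)// ler_pM2l// ltW.
  have h3 : - ln (kappa * Delta2) <= 8 / 9 * (Num.sqrt kappa * Num.sqrt eps)^-1.
    by apply: (le_trans h1); rewrite ler_wpM2l.
  pose c := Num.sqrt D * (kappa * Num.sqrt kappa) / Num.sqrt eps.
  have c0 : 0 <= c by rewrite divr_ge0 ?mulr_ge0 ?(ltW k0) ?(ltW sk0) ?(ltW se0).
  have h4 := ler_wpM2l c0 h3.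
  have e1 : c * (8 / 9 * (Num.sqrt kappa * Num.sqrt eps)^-1) = 8 / 9 * (Num.sqrt D * kappa / eps).
    rewrite /c -[in RHS](sqr_sqrtr (ltW eps0)); field.
    by rewrite !gt_eqF.
  have e2 : Num.sqrt D * (kappa * Num.sqrt kappa) * ln (kappa * Delta2) / Num.sqrt eps =
    - (c * - ln (kappa * Delta2)) by rewrite /c; ring.
  have h5 : Num.sqrt D * kappa / eps <= q.
    by rewrite /q ler_wpM2r ?invr_ge0 ?(ltW eps0)// ler_wpM2r// ltW.
  rewrite e2; rewrite e1 in h4; lra.
have q0 : 0 <= q by exact: term1.
have Tq : 100 * q <= T%:R by have := term3; move: hT; rewrite -/D -/q => hT t3; lra.
have k20 : 0 <= 20 * kappa ^+ 2 by rewrite mulr_ge0 ?sqr_ge0.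
have := @stage2 (scaled_schedule kappa 0 (20 * kappa ^+ 2)) K Delta2 0 _ k20 K0
  (fun t h => @scaled_schedule_ge kappa 0 (20 * kappa ^+ 2) t h) T.
rewrite add0n /= add0r; set s := T%:R + _; set RT := noisy_contraction _ _ _ _ => st2.
have Ts : T%:R <= s by rewrite /s lerDl.
have sq : 100 * q <= s by exact: le_trans Tq Ts.
have qpos : 0 < q by apply: lt_le_trans q_ge; have := k2; lra.
have spos : 0 < s by lra.
apply: (@final_bound RT ((20 * kappa ^+ 2) ^+ 2 * Delta2) s) => //.
- apply: (le_trans st2); rewrite lerD2l ler_wpM2l// mulr_ge0//.
- have s2 : (100 * q) ^+ 2 <= s ^+ 2.
    have q100 : 0 <= 100 * q by rewrite mulr_ge0.
    by rewrite lerXn2r ?nnegrE ?(ltW spos).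
  have := ler_wpM2r (ltW eps0) s2.
  have -> : (100 * q) ^+ 2 * eps = 10000 * (q * (eps * q)) by ring.
  rewrite eq_q => h.
  have h6 : kappa ^+ 2 * kappa <= q * (D * kappa).
    rewrite ler_pM ?sqr_ge0 ?(ltW k0)// ler_peMl ?(ltW k0)//.
  have h8 : 0 <= kappa ^+ 2 * kappa by rewrite mulr_ge0 ?sqr_ge0 ?(ltW k0).
  have h7 : (20 * kappa ^+ 2) ^+ 2 * Delta2 <= 1600 * (kappa ^+ 2 * kappa).
    have -> : (20 * kappa ^+ 2) ^+ 2 * Delta2 = 400 * (kappa ^+ 2 * kappa * (kappa * Delta2)) by ring.
    by have := ler_wpM2l h8 kD4; lra.
  rewrite mulrA; lra.
- have := ler_wpM2l (ltW eps0) sq; rewrite mulrCA eq_q /K => h.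
  have : 0 <= D * kappa by rewrite -eq_q mulr_ge0// ltW.
  by rewrite [kappa * D]mulrC; lra.
Qed.

(** The constant-step phase runs until the initial error has shrunk by the factor [kappa * Delta2],
    down to [1 / kappa]; the second phase then averages out the noise. *)
Lemma rate_high : 4 < kappa * Delta2 -> exists tstar, goal tstar (20 * kappa ^+ 2).
Proof.
move=> kD4; have y1 : 0 < kappa * Delta2 by rewrite mulr_gt0.
set ell := ln (kappa * Delta2).
have ell34 : 3 / 4 <= ell.
  apply: le_trans (ln_ge_one_sub_inv y1).
  have : (kappa * Delta2)^-1 <= 4^-1 by rewrite lef_pV2 ?posrE// ltW.
  lra.
have kl : 3 / 4 <= kappa ^+ 2 * ell.
  by apply: (le_trans ell34); rewrite ler_peMl//; lra.
have x0 : 0 <= 10 * (kappa ^+ 2 * ell) by lra.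
have [tstar [tx txu tmin]] := least_nat_ge x0.
exists tstar => T; rewrite /complexity -/D -/ell => hT.
have se0 : 0 < Num.sqrt eps by rewrite sqrtr_gt0.
have sk0 : 0 < Num.sqrt kappa by rewrite sqrtr_gt0.
have sD0 : 0 <= Num.sqrt D by exact: sqrtr_ge0.
pose p := Num.sqrt D * (kappa * Num.sqrt kappa) * ell / Num.sqrt eps.
have tq : 0 <= q by exact: term1.
have tp : 0 <= p by apply: term2; lra.
have [Tq Tp] : 100 * q <= T%:R /\ 100 * p <= T%:R.
  by have := term3; move: hT; rewrite -/q -/p => hT t3; split; lra.
have ep : eps * p ^+ 2 = D * kappa ^+ 3 * ell ^+ 2.
  rewrite /p -{1}(sqr_sqrtr (ltW eps0)).
  have -> : D * kappa ^+ 3 * ell ^+ 2 = Num.sqrt D ^+ 2 * kappa ^+ 2 * Num.sqrt kappa ^+ 2 * ell ^+ 2.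
    by rewrite !sqr_sqrtr ?ler0n ?(ltW k0)//; ring.
  by field; rewrite gt_eqF.
(* Since [D / eps > kappa], the middle term of the complexity dominates the length of the first
   phase. *)
have pk : kappa ^+ 2 * ell <= p.
  have -> : p = kappa * ell * Num.sqrt kappa * (Num.sqrt D / Num.sqrt eps) by rewrite /p; ring.
  have -> : kappa ^+ 2 * ell = kappa * ell * Num.sqrt kappa * Num.sqrt kappa.
    by rewrite -mulrA -expr2 sqr_sqrtr ?(ltW k0)//; ring.
  rewrite ler_wpM2l ?mulr_ge0 ?(ltW k0) ?(ltW sk0)//; first by lra.
  rewrite ler_pdivlMr// -sqrtrM ?(ltW k0)// ler_sqrt ?ler0n//.
  by rewrite mulrC -ler_pdivlMr// ltW.
have tT : (tstar <= T)%N by apply: tmin; lra.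
(* The contracted initial error is at most [1 / kappa <= D / kappa], and the noise level adds
   [4/5 (D / kappa)]. *)
have st1 : Rseq (scaled_schedule kappa tstar (20 * kappa ^+ 2)) K Delta2 tstar <= 2 * (D / kappa).
  have e := stage1 K Delta2 hle01 (@scaled_schedule_lt kappa tstar (20 * kappa ^+ 2)) (leqnn tstar).
  rewrite -/h0 N0 in e.
  have le1 := one_sub_expn_le tstar hle01.
  have le2 : expR (- (h0 * tstar%:R)) <= (kappa * Delta2)^-1.
    rewrite -(lnK (x := kappa * Delta2)) ?posrE// -expRN ler_expR lerN2 -/ell.
    by rewrite [h0 * _]mulrC /h0 ler_pdivlMr//; apply: le_trans tx; lra.
  have p0 : 0 <= (1 - h0) ^+ tstar by rewrite exprn_ge0// subr_ge0.
  have P1 : (1 - h0) ^+ tstar <= (kappa * Delta2)^-1 by exact: le_trans le1 le2.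
  move: e p0 P1; set P := (1 - h0) ^+ tstar; set RR := noisy_contraction _ _ _ _ => e p0 P1.
  have := ler_wpM2r (ltW y0) P1.
  have -> : (kappa * Delta2)^-1 * Delta2 = kappa^-1 by field; rewrite !gt_eqF.
  have ik : 0 < kappa^-1 by rewrite invr_gt0.
  have h9 : kappa^-1 <= D / kappa by rewrite ler_peMl// ltW.
  have h10 : 0 <= P * (D / kappa) by rewrite mulr_ge0// ltW// (lt_le_trans ik).
  have e11 : P * (Delta2 - 4 / 5 * (D / kappa)) = P * Delta2 - 4 / 5 * (P * (D / kappa)) by ring.
  rewrite e11 in e; lra.
have k20 : 0 <= 20 * kappa ^+ 2 by rewrite mulr_ge0 ?sqr_ge0.
have := @stage2 (scaled_schedule kappa tstar (20 * kappa ^+ 2)) K Delta2 tstar _ k20 K0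
  (fun t h => @scaled_schedule_ge kappa tstar (20 * kappa ^+ 2) t h) (T - tstar).
rewrite subnKC//; set s := T%:R + _; set RT := noisy_contraction _ _ _ T => st2.
have Ts : T%:R <= s by rewrite /s lerDl.
have spos : 0 < s by lra.
apply: (@final_bound RT ((tstar%:R + 20 * kappa ^+ 2) ^+ 2 *
    Rseq (scaled_schedule kappa tstar (20 * kappa ^+ 2)) K Delta2 tstar) s) => //.
- have K32 : 0 <= 32 * K by exact: mulr_ge0.
  apply: (le_trans st2); rewrite lerD2l; apply: (ler_wpM2l K32).
  by apply: le_trans Ts; rewrite ler_nat leq_subr.
- set M := kappa ^+ 2 * ell in kl pk tx txu *.
  (* From [ell >= 3/4]: [20 kappa^2 <= 27 M]. Together with [tstar < 10 M + 1] and [1 <= 4/3 M], the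
     starting weight stays below [40 M]. *)
  have kM : 20 * kappa ^+ 2 <= 27 * M.
    have := ler_wpM2l (sqr_ge0 kappa) ell34; rewrite -/M; have := k2; lra.
  have t0 : 0 <= tstar%:R + 20 * kappa ^+ 2 by rewrite addr_ge0.
  have b1 : (tstar%:R + 20 * kappa ^+ 2) ^+ 2 <= (40 * M) ^+ 2.
    rewrite lerXn2r ?nnegrE//; lra.
  have D0 : 0 <= 2 * (D / kappa) by rewrite mulr_ge0// divr_ge0 ?ler0n// ltW.
  apply: (@le_trans _ _ ((40 * M) ^+ 2 * (2 * (D / kappa)))).
    apply: (@le_trans _ _ ((tstar%:R + 20 * kappa ^+ 2) ^+ 2 * (2 * (D / kappa)))).
      by rewrite ler_wpM2l// sqr_ge0.
    by rewrite ler_wpM2r.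
  have -> : (40 * M) ^+ 2 * (2 * (D / kappa)) = 3200 * (D * kappa ^+ 3 * ell ^+ 2).
    by rewrite /M; field; rewrite gt_eqF.
  rewrite -ep.
  have s2 : (100 * p) ^+ 2 <= s ^+ 2.
    have p100 : 0 <= 100 * p by lra.
    have s100 : 100 * p <= s by lra.
    by rewrite lerXn2r ?nnegrE ?(ltW spos).
  have := ler_wpM2r (ltW eps0) s2.
  have -> : (100 * p) ^+ 2 * eps = 10000 * (eps * p ^+ 2) by ring.
  have : 0 <= eps * p ^+ 2 by rewrite mulr_ge0 ?sqr_ge0// ltW.
  rewrite mulrA; lra.
- have := ler_wpM2l (ltW eps0) (le_trans Tq Ts); rewrite mulrCA eq_q /K => h.
  have : 0 <= D * kappa by rewrite -eq_q mulr_ge0// ltW.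
  by rewrite [kappa * D]mulrC; lra.
Qed.

End cases.

Theorem rate_exists (d : nat) (kappa Delta2 eps : R) : (0 < d)%N -> 1 <= kappa -> 0 < eps ->
  exists (tstar : nat) (tau : R), 20 * kappa ^+ 2 <= tau /\
    forall T : nat, 1000 * complexity d kappa Delta2 eps <= T%:R ->
    Rseq (scaled_schedule kappa tstar tau) (kappa * d%:R) Delta2 T <= eps.
Proof.
move=> d1 k1 eps0; have [De|De] := leP Delta2 eps.
  have [|||tau [t1 t2]] := @rate_small d kappa Delta2 eps; rewrite ?De//.
  by exists 0%N, tau.
have [eD|eD] := leP (d%:R / kappa) eps.
  have [|||||tstar h] := @rate_large_eps d kappa Delta2 eps; rewrite ?De//.
  by exists tstar, (20 * kappa ^+ 2).
have [kD|kD] := leP (kappa * Delta2) 4.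
  by exists 0%N, (20 * kappa ^+ 2); split => //; apply: rate_mid.
have [||||||tstar h] := @rate_high d kappa Delta2 eps; rewrite ?De//.
by exists tstar, (20 * kappa ^+ 2).
Qed.

End rates.

(** * Iteration *)

Section iterate.
Context {R : realType} {d : nat}.
Implicit Types l : @param R d.

Lemma Lambda_spgd_step (U : 'cV[R]_d -> R) gam l e : Lambda l -> 0 < gam ->
  Lambda (spgd_step U gam l e).
Proof.
move=> [lC dpos] g0; split => [i j ij|i].
  rewrite /spgd_step /prox /= mxE; case: eqP => [e'|_]; first by rewrite e' ltnn in ij.
  by rewrite !mxE leqNgt ij lC// /= mulr0 subrr.
by rewrite /spgd_step /prox /= mxE eqxx; exact: prox1_gt0.
Qed.

Lemma spgd_E_ge0 (U : 'cV[R]_d -> R) gam t n l (f : @param R d -> \bar R) :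
  (forall l, 0 <= f l)%E -> (0 <= spgd_E U gam t n l f)%E.
Proof.
move=> f0; elim: n t l => [|n IH] t l /=; first exact: f0.
by apply: std_gauss_E_ge0 => e; exact: IH.
Qed.

Variables (U : 'cV[R]_d -> R) (mu L : R).
Hypothesis tdU : twice_differentiable U.
Hypothesis mu0 : 0 < mu.
Hypothesis muL : mu <= L.
Hypothesis hessU : forall z v : 'cV[R]_d,
  mu * (v^T *m v) 0 0 <= (v^T *m hess U z *m v) 0 0 /\
  (v^T *m hess U z *m v) 0 0 <= L * (v^T *m v) 0 0.
Variable ls : @param R d.
Hypothesis Lls : Lambda ls.
Hypothesis opt : forall l, Lambda l -> (free_energy U ls <= free_energy U l)%E.
Variable gam : nat -> R.
Hypothesis gam_bounds : forall t, 0 < gam t <= (10 * L * (L / mu))^-1.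

(** Keeps the coefficient [A] of the affine majorants nonnegative through the induction. *)
Let gam_mu t : gam t * mu <= 1.
Proof.
have L0 : 0 < L by exact: lt_le_trans mu0 muL.
have /andP[_ h] := gam_bounds t.
have den : 0 < 10 * L * (L / mu) by rewrite !mulr_gt0 ?invr_gt0.
apply: (@le_trans _ _ ((10 * L * (L / mu))^-1 * mu)); first by rewrite ler_pM2r.
rewrite mulrC ler_pdivrMr// mul1r.
have k1 : 1 <= L / mu by rewrite ler_pdivlMr// mul1r.
apply: (le_trans muL); rewrite -[leLHS]mulr1 ler_pM ?(ltW L0)//.
by rewrite ler_peMl ?(ltW L0)// ler1n.
Qed.

(* [A] and [B] are left implicit: only their domination by supersolutions of the scalar recursion is used. *)
Lemma spgd_E_le n t : exists A B : R, [/\ 0 <= A, 0 <= B,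
  forall l, Lambda l -> (spgd_E U gam t n l (fun l => W2sq (q_law l) (q_law ls)) <=
    (A * param_sqnorm (param_sub l ls) + B)%:E)%E &
  forall rho : nat -> R,
    (forall k, (1 - gam k * mu) * rho k + 8 * gam k ^+ 2 * L * d%:R <= rho k.+1) ->
    A * rho t + B <= rho (t + n)%N].
Proof.
have L0 : 0 < L by exact: lt_le_trans mu0 muL.
elim: n t => [|n IH] t.
  exists 1, 0; split => // [l Ll|rho _]; last by rewrite addn0 mul1r addr0.
  by rewrite mul1r addr0; exact: W2sq_le.
have [A [B [A0 B0 hl hr]]] := IH t.+1.
have /andP[g0 g1] := gam_bounds t.
have c0 : 0 <= 8 * gam t ^+ 2 * L * d%:R.
  apply: mulr_ge0; last exact: ler0n.
  by apply: mulr_ge0; [apply: mulr_ge0 => //; exact: sqr_ge0|exact: ltW].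
exists (A * (1 - gam t * mu)), (A * (8 * gam t ^+ 2 * L * d%:R) + B); split.
- by rewrite mulr_ge0// subr_ge0.
- by rewrite addr_ge0// mulr_ge0.
- move=> l Ll /=.
  apply: (@le_trans _ _ (std_gauss_E (fun e =>
     (A * param_sqnorm (param_sub (spgd_step U (gam t) l e) ls) + B)%:E))).
    apply: std_gauss_E_le => e; first by apply: spgd_E_ge0 => l'; exact: W2sq_ge0.
    by apply: hl; exact: Lambda_spgd_step.
  apply: le_trans (step_gaussE tdU mu0 muL hessU Lls opt Ll g0 A0 B0 g1) _.
  by rewrite lee_fin le_eqVlt; apply/orP; left; apply/eqP; ring.
- move=> rho hrho; rewrite addnS -addSn; apply: le_trans (hr rho hrho).
  have := ler_wpM2l A0 (hrho t); rewrite mulrDr; lra.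
Qed.

End iterate.

(** * From the scaled recursion back to the original step sizes *)

Lemma schedule_scaled {R : realType} (mu L : R) tstar tau t : 0 < mu -> 0 < L ->
  schedule mu L tstar tau t = mu^-1 * scaled_schedule (L / mu) tstar tau t.
Proof.
move=> mu0 L0; rewrite /schedule /scaled_schedule; case: ifP => // _.
by field; rewrite !gt_eqF.
Qed.

(** In dimension zero no nonzero vector is available to force [mu <= L], so this case is settled
    separately: the parameter space is a point and the distance vanishes. *)
Lemma spgd_E_dim0 {R : realType} (U : 'cV[R]_0 -> R) gam t n (l ls : @param R 0) :
  (spgd_E U gam t n l (fun l => W2sq (q_law l) (q_law ls)) <= 0)%E.
Proof.
elim: n t l => [|n IH] t l /=; last exact: IH.
apply: (le_trans (W2sq_le l ls)).
by rewrite lee_fin /param_sqnorm !big_ord0 addr0.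
Qed.

Theorem theorem3p3 (R : realType) :
  exists c : R, 0 < c /\
  forall (d : nat) (U : 'cV[R]_d -> R) (mu L : R),
    twice_differentiable U ->
    0 < mu -> 0 <= L ->
    (forall (z v : 'cV[R]_d),
        mu * (v^T *m v) 0 0 <= (v^T *m hess U z *m v) 0 0 /\
        (v^T *m hess U z *m v) 0 0 <= L * (v^T *m v) 0 0) ->
    let kappa := L / mu in
    forall lstar : @param R d,
      Lambda lstar ->
      (forall l : @param R d, Lambda l -> (free_energy U lstar <= free_energy U l)%E) ->
    forall l0 : @param R d,
      Lambda l0 ->
      let Delta2 := mu * param_sqnorm (param_sub l0 lstar) in
    forall eps : R, 0 < eps ->
    exists (tstar : nat) (tau : R), 0 <= tau /\
      forall T : nat,
        c * (d%:R * kappa / eps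
             + Num.sqrt d%:R * (kappa * Num.sqrt kappa) * ln (kappa * Delta2) / Num.sqrt eps
             + kappa ^+ 2 * ln (Delta2 / eps)) <= T%:R ->
        (mu%:E * spgd_E U (schedule mu L tstar tau) 0 T l0
                   (fun l => W2sq (q_law l) (q_law lstar)) <= eps%:E)%E.
Proof.
exists 1000; split; first by rewrite ltr0n.
move=> d U mu L tdU mu0 _ hessU kappa ls Lls opt l0 Ll0 Delta2 eps eps0.
have muE0 : (0 <= mu%:E)%E by rewrite lee_fin ltW.
have [d0|d0] := posnP d.
  move: U tdU hessU ls Lls opt l0 Ll0 @Delta2; rewrite d0 => U _ _ ls _ _ l0 _ Delta2.
  exists 0%N, 0; split => // T _.
  apply: (@le_trans _ _ (mu%:E * 0)%E); last by rewrite mule0 lee_fin ltW.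
  by apply: lee_wpmul2l => //; exact: spgd_E_dim0.
have muL : mu <= L.
  pose v : 'cV[R]_d := delta_mx (Ordinal d0) 0.
  have vv : (v^T *m v) 0 0 = 1.
    rewrite dotE /dot (bigD1 (Ordinal d0))//= big1 => [|i ni]; rewrite !mxE ?eqxx.
      by rewrite mulr1 addr0.
    by rewrite (negbTE ni) mul0r.
  by have [h1 h2] := hessU 0 v; have := le_trans h1 h2; rewrite vv !mulr1.
have L0 : 0 < L by exact: lt_le_trans mu0 muL.
have k1 : 1 <= kappa by rewrite ler_pdivlMr// mul1r.
have [tstar [tau [tauk hT]]] := rate_exists Delta2 d0 k1 eps0.
exists tstar, tau; split; first by apply: le_trans tauk; rewrite mulr_ge0 ?sqr_ge0.
move=> T hc; have {}hT := hT T hc.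
pose gam := schedule mu L tstar tau.
have gE t : gam t = mu^-1 * scaled_schedule kappa tstar tau t by exact: schedule_scaled.
have gb t : 0 < gam t <= (10 * L * (L / mu))^-1.
  have /andP[h1 h2] := scaled_schedule_bounds tstar t k1 tauk.
  rewrite gE mulr_gt0 ?invr_gt0//=.
  have -> : (10 * L * (L / mu))^-1 = mu^-1 * (10 * kappa ^+ 2)^-1.
    by rewrite /kappa; field; rewrite !gt_eqF.
  by rewrite ler_pM2l ?invr_gt0.
have [A [B [A0 B0 hl hr]]] := spgd_E_le tdU mu0 muL hessU Lls opt gb T 0.
set S := noisy_contraction (scaled_schedule kappa tstar tau) (kappa * d%:R) Delta2 in hT.
(* Divided by [mu], the scaled recursion satisfies the unscaled one with equality, hence qualifies
   as a supersolution. *)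
have hS k : (1 - gam k * mu) * (S k / mu) + 8 * gam k ^+ 2 * L * d%:R <= S k.+1 / mu.
  rewrite gE /S /= -/(S k) /kappa; set h := scaled_schedule _ _ _ _; set s := S k.
  rewrite le_eqVlt; apply/orP; left; apply/eqP.
  by field; rewrite gt_eqF.
have := hr (fun k => S k / mu) hS; rewrite add0n => hAB.
apply: (@le_trans _ _ (mu%:E * (A * param_sqnorm (param_sub l0 ls) + B)%:E)%E).
  by apply: lee_wpmul2l => //; exact: hl.
rewrite -EFinM lee_fin (le_trans _ hT)//.
have S0 : S 0%N / mu = param_sqnorm (param_sub l0 ls).
  by rewrite /S /= /Delta2 mulrC mulKf ?gt_eqF.
rewrite S0 in hAB; rewrite mulrC -ler_pdivlMr//; exact: hAB.
Qed.
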